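(* Let $\lambda(r)=\dfrac{1}{(1-r)\left(\log\frac1{1-r}\right)^2}$ for $1/2\le r<1$, let $\mathrm{wash}=\{(r\cos\phi,r\sin\phi,0):1/2\le r<1,\ -\pi\le\phi<\pi\}\subset\mathbb R^3$, and let $\mathbf J$ be the planar current density on $\mathrm{wash}$ given by $$\mathbf J(\mathbf x)=\lambda(r)\,(-\sin\phi,\cos\phi,0)\quad\text{for }\mathbf x=(r\cos\phi,r\sin\phi,0).$$ Let $\mathbf A$ be the magnetic potential on $\mathbb R^3$ $$\mathbf A(\mathbf x)=\frac1{4\pi}\int_{\mathrm{wash}}\frac{\mathbf J(\mathbf x')}{|\mathbf x-\mathbf x'|}\,d^2\mathbf x'.$$ Then: 1) The gauge potential $\mathbf A$ has finite energy, i.e. $$W=\int_{\mathrm{wash}}\int_{\mathrm{wash}}\frac{\mathbf J(\mathbf x)\cdot\mathbf J(\mathbf x')}{|\mathbf x-\mathbf x'|}\,d^2\mathbf x\,d^2\mathbf x'<\infty .$$ 2) There are piecewise smooth closed curves $C$ of finite length in the $x,y$ plane through which the magnetic flux is infinite, i.e. $\int_C\mathbf A(\mathbf x)\cdot d\mathbf x=+\infty$. In particular the holonomy (Wilson loop) $W_C(\mathbf A)=\exp\left(i\int_C\mathbf A\cdot d\mathbf x\right)$ is undefined for such a curve $C$.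
   Context: $d^2\mathbf x$ denotes two-dimensional area measure on the plane region $\mathrm{wash}$ (an annulus of zero thickness). The component of $\mathbf A(\mathbf x)$ in a unit direction $\mathbf t$ is $\frac1{4\pi}\int_{\mathrm{wash}}\frac{\mathbf J(\mathbf x')\cdot\mathbf t}{|\mathbf x-\mathbf x'|}d^2\mathbf x'$, which is allowed to take the value $+\infty$ (when the negative part of the integrand is integrable and the positive part is not). The line integral $\int_C\mathbf A\cdot d\mathbf x$ is the integral over $C$ with respect to arc length of the component of $\mathbf A$ along the unit tangent of $C$, in the extended real sense. The gauge group is the circle group, and the flux through a planar closed curve $C$ is by definition $\int_C\mathbf A\cdot d\mathbf x$. *)

(* Defs.v *)
From HB Require Import structures.
From mathcomp Require Import all_boot all_order all_algebra.
From mathcomp Require Import all_classical all_reals all_analysis.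
From mathcomp Require Import measurable_realfun.
From mathcomp Require complex.

Set Implicit Arguments.
Unset Strict Implicit.
Unset Printing Implicit Defensive.

Import Order.TTheory GRing.Theory Num.Theory.
Import numFieldNormedType.Exports.

Local Open Scope classical_set_scope.
Local Open Scope ring_scope.

Section Space.
Context {R : realType}.

Definition vec3 (x y z : R) : 'rV[R]_3 := \row_(i < 3) [:: x; y; z]`_i.

Definition dot (u v : 'rV[R]_3) : R := \sum_(i < 3) u 0 i * v 0 i.

(* The library norm `|u| on 'rV[R]_3 is the sup norm, hence this one. *)
Definition enorm (u : 'rV[R]_3) : R := Num.sqrt (dot u u).

End Space.

Notation area R := (@lebesgue_measure R \x @lebesgue_measure R)%E.

Section Integration.
Context {R : realType}.

Definition plane (p : R * R) : 'rV[R]_3 := vec3 p.1 p.2 0.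

(* Integral d^2x of f over a subset S of the plane z = 0. *)
Definition area_integral (S : set 'rV[R]_3) (f : 'rV[R]_3 -> \bar R) : \bar R :=
  (\int[area R]_(p in plane @^-1` S) f (plane p))%E.

(* f has an integral over D in the extended real sense. The library's \int is
   the difference of the integrals of the positive and negative parts, also
   when both are +oo (and it is then -oo by convention), and it is
   total on non-measurable functions; both cases are excluded here. *)
Definition quasi_integrable d (T : measurableType d)
    (mu : {measure set T -> \bar R}) (D : set T) (f : T -> \bar R) : Prop :=
  measurable_fun D f /\
  ((\int[mu]_(x in D) f^\+ x < +oo)%E \/ (\int[mu]_(x in D) f^\- x < +oo)%E).

End Integration.

Section Curves.
Context {R : realType}.

Definition smooth (f : R -> 'rV[R]_3) : Prop :=
  forall (n : nat) (s : R), derivable (derive1n n f) s 1.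

(* Smoothness on the closed interval [s, t] is smooth extendability to R. *)
Definition smooth_regular_piece (s t : R) (g : R -> 'rV[R]_3) : Prop :=
  exists f : R -> 'rV[R]_3, smooth f /\
    forall u, s <= u <= t -> g u = f u /\ derive1 f u != 0.

(* A curve is g restricted to [a, b]. Consecutive closed pieces share their
   common break point, so that g is continuous on [a, b]. *)
Definition piecewise_smooth (a b : R) (g : R -> 'rV[R]_3) : Prop :=
  exists (n : nat) (t : nat -> R), [/\ t 0%N = a, t n.+1 = b &
    forall i, (i <= n)%N ->
      t i < t i.+1 /\ smooth_regular_piece (t i) (t i.+1) g].

Definition closed_curve (a b : R) (g : R -> 'rV[R]_3) : Prop := g a = g b.

Definition in_xy_plane (a b : R) (g : R -> 'rV[R]_3) : Prop :=
  forall u, a <= u <= b -> exists p : R * R, g u = plane p.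

Definition speed (g : R -> 'rV[R]_3) (u : R) : R := enorm (derive1 g u).

Definition unit_tangent (g : R -> 'rV[R]_3) (u : R) : 'rV[R]_3 :=
  (speed g u)^-1 *: derive1 g u.

Definition curve_length (a b : R) (g : R -> 'rV[R]_3) : \bar R :=
  (\int[lebesgue_measure]_(u in `[a, b]) (speed g u)%:E)%E.

End Curves.

Section Washer.
Context {R : realType}.

Definition lambda (r : R) : R := ((1 - r) * (ln (1 - r)^-1) ^+ 2)^-1.

Definition wash : set 'rV[R]_3 :=
  [set x | exists r phi : R, [/\ 1 / 2 <= r < 1, - pi <= phi < pi &
    x = vec3 (r * cos phi) (r * sin phi) 0]].

Definition wash_current (J : 'rV[R]_3 -> 'rV[R]_3) : Prop :=
  forall r phi : R, 1 / 2 <= r < 1 -> - pi <= phi < pi ->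
    J (vec3 (r * cos phi) (r * sin phi) 0)
    = lambda r *: vec3 (- sin phi) (cos phi) 0.

(* Polar coordinates are consistent on wash, so such a J exists. *)
Lemma wash_current_exists : exists J, wash_current J.
Proof.
pose rho (x : 'rV[R]_3) := enorm x.
exists (fun x => (lambda (rho x) / rho x) *:
  vec3 (- x 0 (inord 1)) (x 0 (inord 0)) 0) => r phi /andP[r1 _] _.
have r0 : 0 < r by apply: lt_le_trans r1; rewrite divr_gt0.
have -> : rho (vec3 (r * cos phi) (r * sin phi) 0) = r.
  rewrite /rho /enorm /dot !big_ord_recl big_ord0 !mxE /= mulr0 !addr0.
  rewrite -!expr2 !exprMn -mulrDr cos2Dsin2 mulr1 sqrtr_sqr.
  exact: gtr0_norm.
apply/rowP => -[[|[|[|//]]] ilt]; rewrite !mxE !inordK //=.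
- by rewrite -mulrN mulrA mulfVK ?gt_eqF.
- by rewrite mulrA mulfVK ?gt_eqF.
- by rewrite !mulr0.
Qed.

End Washer.

Section Gauge.
Context {R : realType}.
Variable J : 'rV[R]_3 -> 'rV[R]_3.

Definition potential_density (x t x' : 'rV[R]_3) : R :=
  dot (J x') t / enorm (x - x').

(* The component A(x).t of the magnetic potential of J. *)
Definition potential (x t : 'rV[R]_3) : \bar R :=
  (((4 * pi)^-1)%:E *
   area_integral wash (fun x' => (potential_density x t x')%:E))%E.

Definition potential_defined (x t : 'rV[R]_3) : Prop :=
  quasi_integrable (area R) (plane @^-1` wash)
    (fun p => (potential_density x t (plane p))%:E).

Definition energy_density (x x' : 'rV[R]_3) : R :=
  dot (J x) (J x') / enorm (x - x').

Definition energy : \bar R :=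
  area_integral wash (fun x =>
    area_integral wash (fun x' => (energy_density x x')%:E)).

(* Absolute convergence of the double integral is required because the energy
   density changes sign. *)
Definition finite_energy : Prop :=
  integrable (area R \x area R)%E ((plane @^-1` wash) `*` (plane @^-1` wash))
    (fun q => (energy_density (plane q.1) (plane q.2))%:E)
  /\ (energy < +oo)%E.

Definition flux_density (g : R -> 'rV[R]_3) (u : R) : \bar R :=
  (potential (g u) (unit_tangent g u) * (speed g u)%:E)%E.

Definition flux (a b : R) (g : R -> 'rV[R]_3) : \bar R :=
  (\int[lebesgue_measure]_(u in `[a, b]) flux_density g u)%E.

Definition flux_defined (a b : R) (g : R -> 'rV[R]_3) : Prop :=
  {ae lebesgue_measure, forall u : R, `[a, b]%classic u ->
    potential_defined (g u) (unit_tangent g u)} /\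
  quasi_integrable lebesgue_measure `[a, b] (flux_density g).

(* z = exp(i Phi) for Phi the flux, which has to be a real number. *)
Definition is_holonomy (a b : R) (g : R -> 'rV[R]_3) (z : complex.complex R)
    : Prop :=
  flux_defined a b g /\
  exists Phi : R, flux a b g = Phi%:E /\ z = complex.Complex (cos Phi) (sin Phi).

End Gauge.

(* Main.v *)
(* Write s = 1 - |x| for the depth of a point of the washer, so that the current has size
   1 / (s log(1/s)^2).

   Energy.  Since |s - s'| <= |x - x'|, either the distance dominates both depths or the two
   depths are comparable.  In both cases the four logarithms of lambda(r) lambda(r') can be
   shared out so that lambda(r) lambda(r') / |x - x'| is at most a sum of products of three
   one-variable functions h(z) = 1 / (z log(1/z)^(4/3)), evaluated at s, s', and the
   coordinates of x - x'.  As h is integrable at 0, Tonelli's theorem in Cartesian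
   coordinates bounds the energy.

   Flux.  Take for C the unit circle.  Near a point x of C the density of the axial component
   is at least c / (a t log(1/t)^2) on a set of points with offset a along C and depth about t
   in [a^2, a].  The t-integral is of order 1 / log(1/a), and 1 / (a log(1/a)) is not
   integrable at 0, so the component is +oo.  This is only needed on an arc around (1, 0, 0):
   on the whole circle the negative part is at most the integral of lambda, because it comes
   from points at distance at least 1. *)

From HB Require Import structures.
Require Import Defs.
From mathcomp Require Import all_boot all_order all_algebra.
From mathcomp Require Import all_classical all_reals all_analysis.
From mathcomp Require Import measurable_realfun ring lra.
From mathcomp Require complex.
Import Order.TTheory GRing.Theory Num.Theory.
Import numFieldNormedType.Exports.
Local Open Scope classical_set_scope.
Local Open Scope ring_scope.

(** * Logarithmic weights *)

(* Since |x - y| < 2 on the washer, the shift by 4 keeps the logarithm above 3,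
   which makes [x * ell x ^+ n] increasing for n <= 9. *)
Definition ell {R : realType} (x : R) : R := (4 - ln x) `^ 3^-1.

(* Logarithmic exponent 4/3: it exceeds 1, so [dens] is integrable at 0, and three
   such factors absorb only the four logarithms of [lambda r * lambda r']. *)
Definition dens {R : realType} (x : R) : R := (x * ell x ^+ 4)^-1.

Section Weights.
Context {R : realType}.
Implicit Types x y a b d s t : R.

Lemma ln_sub_ge3 x : 0 < x <= 2 -> 3 <= 4 - ln x.
Proof.
move=> /andP[x0 x2]; have := ln_sublinear x0; have : ln x <= ln 2 by rewrite ler_ln ?posrE.
have : ln (1 + 1) <= 1 :> R by apply: le_ln1Dx; lra.
by rewrite (_ : 1 + 1 = 2 :> R); [lra|ring].
Qed.

(** The cube root in [ell] keeps all exponents integral: the square of the logarithm becomes a sixth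
    power and the exponent 4/3 a fourth power. *)
Lemma ell_cube x : 0 < x <= 2 -> ell x ^+ 3 = 4 - ln x.
Proof.
move=> xr; have L3 := ln_sub_ge3 x xr.
by rewrite -powR_mulrn ?powR_ge0// -powRrM mulVf// powRr1//; lra.
Qed.

Lemma ell_gt0 x : 0 < x <= 2 -> 0 < ell x.
Proof. by move=> xr; rewrite powR_gt0//; have := ln_sub_ge3 x xr; lra. Qed.

Lemma ell_le x y : 0 < x -> x <= y -> y <= 2 -> ell y <= ell x.
Proof.
move=> x0 xy y2; have y0 : 0 < y by exact: lt_le_trans xy.
have xr : 0 < x <= 2 by rewrite x0 (le_trans xy).
have yr : 0 < y <= 2 by rewrite y0.
rewrite ge0_ler_powR ?nnegrE ?invr_ge0//; last by rewrite lerD2l lerN2 ler_ln.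
- by have := ln_sub_ge3 y yr; lra.
- by have := ln_sub_ge3 x xr; lra.
Qed.

(** With Y = 4 - ln y and t = ln y - ln x the claim is (Y + t)^3 <= e^t Y^3. Its cube root Y + t <=
    e^(t/3) Y follows from 1 + t/3 <= e^(t/3) and Y >= 3. *)
Lemma ell_growth x y : 0 < x -> x <= y -> y <= 2 ->
  x * ell x ^+ 9 <= y * ell y ^+ 9.
Proof.
move=> x0 xy y2; have y0 : 0 < y by exact: lt_le_trans xy.
have xr : 0 < x <= 2 by rewrite x0 (le_trans xy).
have yr : 0 < y <= 2 by rewrite y0.
rewrite (exprM _ 3 3) (exprM (ell y) 3 3) !ell_cube//.
have Ly := ln_sub_ge3 y yr; set Y := 4 - ln y in Ly *.
have t0 : 0 <= ln y - ln x by rewrite subr_ge0 ler_ln.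
set t := ln y - ln x in t0.
have -> : 4 - ln x = Y + t by rewrite /Y /t; ring.
have -> : y = x * expR t by rewrite expRB !lnK ?posrE// mulrC divfK ?gt_eqF.
rewrite -mulrA ler_pM2l//.
have -> : expR t = expR (t / 3) ^+ 3 by rewrite -expRM_natl; congr expR; field.
rewrite -exprMn ler_pXn2r ?nnegrE//; [|by lra|by rewrite mulr_ge0 ?expR_ge0//; lra].
apply: (@le_trans _ _ ((1 + t / 3) * Y)); first by nra.
by rewrite ler_pM2r; [exact: expR_ge1Dx|lra].
Qed.

(** Dividing the case n = 9 by [ell y ^+ (9 - n)], which is at most [ell x ^+ (9 - n)], gives the
    smaller exponents. *)
Lemma ell_growth_le x y n : (n <= 9)%N -> 0 < x -> x <= y -> y <= 2 ->
  x * ell x ^+ n <= y * ell y ^+ n.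
Proof.
move=> n9 x0 xy y2; have y0 : 0 < y by exact: lt_le_trans xy.
have xr : 0 < x <= 2 by rewrite x0 (le_trans xy).
have yr : 0 < y <= 2 by rewrite y0.
have /= := ell_growth x y x0 xy y2.
rewrite -(subnK n9) !exprD !(mulrCA _ (_ ^+ (9 - n))) => H.
rewrite -(ler_pM2l (exprn_gt0 (9 - n) (ell_gt0 y yr))).
have ex := ltW (ell_gt0 x xr); have ey := ltW (ell_gt0 y yr).
apply: le_trans H; rewrite ler_wpM2r ?mulr_ge0 ?exprn_ge0 ?(ltW x0)//.
by apply: lerXn2r; rewrite ?nnegrE ?ell_le.
Qed.

Lemma dens_gt0 x : 0 < x <= 2 -> 0 < dens x.
Proof.
by move=> xr; rewrite invr_gt0 mulr_gt0 ?exprn_gt0 ?ell_gt0//; case/andP: xr.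
Qed.

Lemma dens_le x y : 0 < x -> x <= y -> y <= 2 -> dens y <= dens x.
Proof.
move=> x0 xy y2; have y0 : 0 < y by exact: lt_le_trans xy.
rewrite lef_pV2 ?posrE ?mulr_gt0 ?exprn_gt0 ?ell_gt0 ?x0 ?y0 ?(le_trans xy)//.
exact: ell_growth_le.
Qed.

Lemma ler_invM (c X Y : R) : 0 < X -> 0 < Y -> Y <= c * X -> X^-1 <= c * Y^-1.
Proof.
by move=> X0 Y0 H; rewrite ler_pdivlMr// mulrC ler_pdivrMr.
Qed.

(** Halving adds ln 2 to the logarithm; after cubing, the factor 8 absorbs it because 4 - ln s >=
    3. *)
Lemma ell_half s : 0 < s <= 2 -> ell (s / 2) <= 2 * ell s.
Proof.
move=> sr; have /andP[s0 s2] := sr.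
have hr : 0 < s / 2 <= 2 by apply/andP; split; lra.
rewrite -(@ler_pXn2r _ 3) ?nnegrE ?mulr_ge0 ?ltW ?ell_gt0//.
rewrite exprMn !ell_cube// lnM ?posrE ?invr_gt0// lnV ?posrE//.
have := ln_sub_ge3 s sr; have := ln_sublinear (ltr0n R 2 : 0 < 2).
by move=> ? ?; lra.
Qed.

(** [dens] keeps four of the six powers of [ell] at s and at t. The two surplus powers at each serve
    d: [ell d ^+ 4 <= 16 * ell s ^+ 4 <= 16 * ell s ^+ 2 * ell t ^+ 2], where 16 = 2^4 comes from
    [ell_half]. *)
Lemma kernel_bound_far d s t : 0 < t -> t <= s -> s <= 1 -> s <= 2 * d -> d <= 2 ->
  (s * ell s ^+ 6)^-1 * (t * ell t ^+ 6)^-1 * d^-1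
  <= 16 * (dens d * dens s * dens t).
Proof.
move=> t0 ts s1 sd d2; have s0 : 0 < s by exact: lt_le_trans ts.
have d0 : 0 < d by lra.
have es : 0 < ell s by apply: ell_gt0; lra.
have et : 0 < ell t by apply: ell_gt0; lra.
have ed : 0 < ell d by apply: ell_gt0; lra.
have est : ell s <= ell t by apply: ell_le => //; lra.
have eds : ell d <= 2 * ell s.
  apply: (le_trans _ (ell_half s _)); last by lra.
  by apply: ell_le; lra.
rewrite /dens; move: (ell s) (ell t) (ell d) es et ed est eds => ls lt ld es et ed est eds.
rewrite -!invfM ler_invM ?mulr_gt0 ?exprn_gt0//.
have H1 : ld ^+ 4 <= 16 * ls ^+ 4.
  rewrite (_ : 16 = 2 ^+ 4 :> R); last by ring.
  by rewrite -exprMn; apply: lerXn2r; rewrite ?nnegrE ?mulr_ge0 ?(ltW es) ?(ltW ed).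
have H2 : ls ^+ 2 <= lt ^+ 2.
  by apply: lerXn2r; rewrite ?nnegrE ?(ltW es) ?(ltW et).
have -> : d * ld ^+ 4 * (s * ls ^+ 4) * (t * lt ^+ 4) =
   (d * s * t * lt ^+ 4 * ls ^+ 4) * ld ^+ 4 by ring.
have -> : 16 * (s * ls ^+ 6 * (t * lt ^+ 6) * d) =
   (d * s * t * lt ^+ 4 * ls ^+ 4) * (16 * ls ^+ 2 * lt ^+ 2) by ring.
rewrite ler_pM2l ?mulr_gt0 ?exprn_gt0//; apply: (le_trans H1).
have -> : 16 * ls ^+ 4 = 16 * ls ^+ 2 * ls ^+ 2 by ring.
by rewrite ler_pM2l ?mulr_gt0 ?exprn_gt0.
Qed.

(** The growth of x ell(x)^4 replaces both a and b by d, and then one factor [d * ell d ^+ 8] is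
    replaced by [s * ell s ^+ 8]. Comparability s <= 2t finally exchanges one s for t, which costs
    the factor 2. *)
Lemma kernel_bound_near a b d s t : 0 < a -> a <= d -> 0 < b -> b <= d ->
  d <= s -> s <= 2 * t -> t <= s -> s <= 1 ->
  (s * ell s ^+ 6)^-1 * (t * ell t ^+ 6)^-1 * d^-1
  <= 2 * (dens a * dens b * dens s).
Proof.
move=> a0 ad b0 bd ds st ts s1.
have d0 : 0 < d by lra. have s0 : 0 < s by lra. have t0 : 0 < t by lra.
have es : 0 < ell s by apply: ell_gt0; lra.
have et : 0 < ell t by apply: ell_gt0; lra.
have ed : 0 < ell d by apply: ell_gt0; lra.
have ea : 0 < ell a by apply: ell_gt0; lra.
have eb : 0 < ell b by apply: ell_gt0; lra.
have est : ell s <= ell t by apply: ell_le => //; lra.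
have Ha : a * ell a ^+ 4 <= d * ell d ^+ 4 by apply: ell_growth_le => //; lra.
have Hb : b * ell b ^+ 4 <= d * ell d ^+ 4 by apply: ell_growth_le => //; lra.
have Hd : d * ell d ^+ 8 <= s * ell s ^+ 8 by apply: ell_growth_le => //; lra.
rewrite /dens; move: (ell s) (ell t) (ell d) (ell a) (ell b) es et ed ea eb est Ha Hb Hd.
move=> ls lt ld la lb es et ed ea eb est Ha Hb Hd; rewrite -!invfM ler_invM ?mulr_gt0 ?exprn_gt0//.
have H2 : ls ^+ 6 <= lt ^+ 6.
  by apply: lerXn2r; rewrite ?nnegrE ?(ltW es) ?(ltW et).
apply: (@le_trans _ _ (d * (d * ld ^+ 8) * (s * ls ^+ 4))).
  rewrite ler_pM2r ?mulr_gt0 ?exprn_gt0//.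
  have -> : d * (d * ld ^+ 8) = (d * ld ^+ 4) * (d * ld ^+ 4) by ring.
  by apply: ler_pM => //; rewrite mulr_ge0 ?exprn_ge0 ?ltW.
apply: (@le_trans _ _ (d * (s * ls ^+ 8) * (s * ls ^+ 4))).
  by rewrite ler_pM2r ?ler_pM2l ?mulr_gt0 ?exprn_gt0.
have -> : d * (s * ls ^+ 8) * (s * ls ^+ 4) =
  (d * s * ls ^+ 6) * (s * ls ^+ 6) by ring.
have -> : 2 * (s * ls ^+ 6 * (t * lt ^+ 6) * d) =
  (d * s * ls ^+ 6) * ((2 * t) * lt ^+ 6) by ring.
rewrite ler_pM2l ?mulr_gt0 ?exprn_gt0//.
by apply: ler_pM; rewrite ?exprn_ge0 ?(ltW es) ?(ltW s0).
Qed.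

End Weights.

(** * Integrals on the line *)

(* The value +oo at 0 lets [spike a * spike b] bound the kernel also on the null set
   where x and y share a coordinate, without almost-everywhere arguments. *)
Definition spike {R : realType} (t : R) : \bar R :=
  if t == 0 then +oo%E else if `|t| <= 2 then (dens `|t|)%:E else 0%E.

Section LineIntegrals.
Context {R : realType}.
Local Notation mu := (@lebesgue_measure R).

Lemma integral_derivative (f F : R -> R) (a b : R) : a < b ->
  (forall x, a <= x <= b -> is_derive x 1 F (f x)) ->
  (forall x, a <= x <= b -> {for x, continuous f}) ->
  (\int[mu]_(x in `[a, b]) (f x)%:E = (F b - F a)%:E)%E.
Proof.
move=> ab dF cf.
have cF x : a <= x <= b -> {for x, continuous F}.
  by move=> /dF D; apply: differentiable_continuous; apply/derivable1_diffP; exact: ex_derive.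
have oc x : x \in `]a, b[ -> a <= x <= b by rewrite in_itv/= => /andP[/ltW-> /ltW->].
rewrite (@continuous_FTC2 _ _ F)//; first last.
- by move=> x /oc/dF D; rewrite derive1E; exact: derive_val.
- split.
  + by move=> x /oc/dF D; exact: ex_derive.
  + by apply: cvg_at_right_filter; apply: cF; rewrite lexx ltW.
  + by apply: cvg_at_left_filter; apply: cF; rewrite lexx ltW.
- by apply: continuous_in_subspaceT => x; rewrite inE /= in_itv/= => /cf.
Qed.

Lemma measurable_inv : measurable_fun [set: R] (fun x : R => x^-1).
Proof.
(* The real power -1 agrees with the inverse on positive reals, so squaring first handles both
   signs; at 0 both sides are 0. *)
rewrite (_ : (fun x => x^-1) = (fun x : R => x * (x ^+ 2) `^ (-1))).
  apply: measurable_funM; first exact: measurable_id.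
  apply: (measurableT_comp (measurable_powR _)).
  exact: measurable_funX.
apply/funext => x; have [->|x0] := eqVneq x 0; first by rewrite invr0 mul0r.
by rewrite powR_inv1 ?sqr_ge0// expr2 invfM mulrA mulfV// mul1r.
Qed.

Lemma measurable_fun_inv d (T : measurableType d) (D : set T) (f : T -> R) :
  measurable_fun D f -> measurable_fun D (fun x => (f x)^-1).
Proof. exact: measurableT_comp measurable_inv. Qed.

Lemma measurable_ell : measurable_fun [set: R] (@ell R).
Proof.
apply: (measurableT_comp (measurable_powR _)).
by apply: measurable_funB; [exact: measurable_cst|exact: measurable_ln].
Qed.

Lemma measurable_dens : measurable_fun [set: R] (@dens R).
Proof.
apply: measurable_fun_inv; apply: measurable_funM => //.
by apply: measurable_funX; exact: measurable_ell.
Qed.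

Lemma measurable_spike : measurable_fun [set: R] (@spike R).
Proof.
apply: measurable_fun_ifT; first exact: measurable_fun_eqr.
  exact: measurable_cst.
apply: measurable_fun_ifT; last exact: measurable_cst.
  by apply: measurable_fun_ler => //; exact: normr_measurable.
apply/measurable_EFinP; apply: (measurableT_comp measurable_dens).
exact: normr_measurable.
Qed.

Lemma spike_ge0 (t : R) : (0 <= spike t)%E.
Proof.
rewrite /spike; case: ifP => // t0; case: ifP => // t2.
by rewrite lee_fin ltW// dens_gt0// normr_gt0 t0.
Qed.

Lemma spikeN (t : R) : spike (- t) = spike t.
Proof. by rewrite /spike oppr_eq0 normrN. Qed.

Lemma spikeE (t : R) : 0 < t <= 2 -> spike t = (dens t)%:E.
Proof. by move=> /andP[t0 t2]; rewrite /spike gt_eqF// gtr0_norm// t2. Qed.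

Lemma ge_spike (t d : R) : `|t| <= d -> 0 < d <= 2 -> ((dens d)%:E <= spike t)%E.
Proof.
move=> td /andP[d0 d2]; rewrite /spike; case: ifPn => [_|t0]; first exact: leey.
by rewrite (le_trans td d2) lee_fin dens_le// normr_gt0.
Qed.

Lemma is_derive_dens_primitive (x : R) : 0 < x <= 2 ->
  is_derive x 1 (fun y => 3 * (4 - ln y) `^ (- 3^-1)) (dens x).
Proof.
move=> xr; have L := ln_sub_ge3 x xr; have /andP[x0 _] := xr.
have D1 : is_derive x 1 (fun y : R => 4 - ln y) (- x^-1).
  rewrite -[- x^-1]add0r; apply: is_deriveB.
  exact: is_derive1_ln.
have D2 : is_derive (4 - ln x) 1 (fun y : R => y `^ (- 3^-1)) (- 3^-1 * (4 - ln x) `^ (- 3^-1 - 1)).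
  by apply: is_derive1_powR; lra.
have D3 := @is_derive1_comp R (fun y => y `^ (- 3^-1)) (fun y => 4 - ln y) x _ _ D2 D1.
have D4 := @is_deriveZ R R R _ (3 : R) x 1 _ D3.
have <- // : 3 *: (- 3^-1 * (4 - ln x) `^ (- 3^-1 - 1) * - x^-1) = dens x.
rewrite /GRing.scale /= /dens.
have -> : (4 - ln x) `^ (- 3^-1 - 1) = (ell x ^+ 4)^-1.
  rewrite -powR_mulrn ?powR_ge0// -powRrM -powRN; congr (_ `^ _); by field.
rewrite invfM; by field; rewrite !gt_eqF ?ell_gt0.
Qed.

Lemma dens_continuous (x : R) : 0 < x <= 2 -> {for x, continuous (@dens R)}.
Proof.
move=> xr; have L := ln_sub_ge3 x xr; have /andP[x0 _] := xr.
apply: cvgV; first by rewrite gt_eqF// mulr_gt0// exprn_gt0// ell_gt0.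
apply: cvgM; first exact: cvg_id.
apply: (@continuous_comp _ _ _ (@ell R) (fun y => y ^+ 4)); last exact: exprn_continuous.
apply: (@continuous_comp _ _ _ (fun y : R => 4 - ln y) (fun y => y `^ 3^-1)).
  by apply: cvgB; [exact: cvg_cst|exact: continuous_ln].
apply: differentiable_continuous; apply/derivable1_diffP.
have D := @is_derive1_powR R 3^-1 (4 - ln x) ltac:(lra).
exact: ex_derive.
Qed.

(** The bound is uniform in e: the primitive 3 (4 - ln y)^(-1/3) is nonnegative at e and at most 3
    at 2. *)
Lemma integral_dens_le (e : R) : 0 < e < 2 ->
  (\int[mu]_(x in `[e, 2%R]) (dens x)%:E <= 3%:E)%E.
Proof.
move=> /andP[e0 e2].
have rng x : e <= x <= 2 -> 0 < x <= 2.
  by move=> /andP[ex x2]; rewrite x2 (lt_le_trans e0 ex).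
have E := integral_derivative (@dens R) (fun y => 3 * (4 - ln y) `^ (- 3^-1)) e 2 e2
  (fun x xe => is_derive_dens_primitive x (rng x xe)) (fun x xe => dens_continuous x (rng x xe)).
rewrite E lee_fin.
have L2 := ln_sub_ge3 (2 : R) ltac:(lra).
have : 0 <= (4 - ln e) `^ (- 3^-1) by exact: powR_ge0.
have : (4 - ln 2) `^ (- 3^-1) <= 1 :> R; last by move=> ? ?; lra.
rewrite powRN invf_le1; last by rewrite powR_gt0//; lra.
by rewrite -[leLHS](congr1 (fun f => f 3^-1) (powR1 R)) ge0_ler_powR ?nnegrE ?invr_ge0//; lra.
Qed.

(** Monotone convergence along the intervals [1/(n+1), 2] carries the uniform bound over to ]0, 2];
    beyond 2 [spike] vanishes. *)
Lemma integral_spike_pos :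
  (\int[mu]_(x in `[0%R, +oo[) spike x <= 3%:E)%E.
Proof.
(* The endpoint 0, where [spike] is +oo, is a null set. *)
rewrite -integral_itv_obnd_cbnd; last exact: measurable_funTS measurable_spike.
pose A (n : nat) : set R := `[n.+1%:R^-1, 2%R]%classic.
have -> : (\int[mu]_(x in `]0%R, +oo[) spike x = \int[mu]_(x in \bigcup_n A n) spike x)%E.
  rewrite integral_mkcond [RHS]integral_mkcond; apply: eq_integral => x _.
  rewrite !patchE; case: ifPn; case: ifPn => //.
  - rewrite notin_setE inE/= in_itv/= andbT => nA x0; rewrite /spike gt_eqF//.
    case: ifPn => // x2; exfalso; apply: nA.
    exists (Num.truncn x^-1) => //=; rewrite /A/= in_itv/=.
    rewrite (ger0_norm (ltW x0)) in x2; rewrite x2 andbT.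
    by rewrite invf_ple ?posrE// ltW// truncnS_gt.
  - rewrite inE => -[n _]; rewrite /A/= in_itv/= => /andP[n1 _].
    rewrite notin_setE/= in_itv/= andbT => /negP; rewrite -leNgt => x0.
    by have := lt_le_trans (lt_le_trans (_ : 0 < n.+1%:R^-1) n1) x0; rewrite invr_gt0 ltr0Sn ltxx => /(_ isT).
have mA n : measurable (A n) by exact: measurable_itv.
have cv := @ge0_nondecreasing_set_cvg_integral _ (measurableTypeR R) R A spike mu.
have {}cv : (\int[mu]_(x in A n) spike x)%E @[n --> \oo] --> (\int[mu]_(x in \bigcup_n A n) spike x)%E.
  apply: cv => //.
  - move=> n m nm; apply/subsetPset => x; rewrite /A/= !in_itv/= => /andP[nx ->].
    by rewrite andbT (le_trans _ nx)// lef_pV2 ?posrE// ler_nat.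
  - by move=> n; exact: measurable_funTS measurable_spike.
  - by move=> *; exact: spike_ge0.
rewrite -(cvg_lim _ cv)//; apply: lime_le; first by apply/cvg_ex; eexists; exact: cv.
apply: nearW => n; rewrite /A.
have e1 : n.+1%:R^-1 <= 1 :> R by rewrite invf_le1// ler1n.
have e0 : 0 < n.+1%:R^-1 :> R by rewrite invr_gt0.
apply: le_trans (integral_dens_le n.+1%:R^-1 _); last first.
  by rewrite e0 (le_lt_trans e1)// ltr1n.
rewrite le_eqVlt; apply/orP; left; apply/eqP/eq_integral => x; rewrite inE/= in_itv/= => /andP[nx x2].
by rewrite spikeE// x2 andbT (lt_le_trans e0).
Qed.

Lemma integral_spike : (\int[mu]_x spike x <= 6%:E)%E.
Proof.
have -> : [set: R] = `]-oo, 0%R] `|` `]0%R, +oo[.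
  by apply/esym/seteqP; split => // x _ /=; rewrite !in_itv/= andbT; have [|] := leP x 0; [left|right].
rewrite ge0_integral_setU//=; last 3 first.
- exact: measurable_funTS measurable_spike.
- by move=> x _; exact: spike_ge0.
- apply/disj_setPS => x [] /=; rewrite !in_itv/= andbT => x0 x1.
  by move: (lt_le_trans x1 x0); rewrite ltxx.
rewrite integral_itv_obnd_cbnd; last exact: measurable_funTS measurable_spike.
have := ge0_integration_by_substitution0 measurable_spike spike_ge0.
under [X in _ = X -> _]eq_integral do rewrite spikeN.
move=> <-; rewrite (_ : 6 = 3 + 3 :> R); last by ring.
by rewrite EFinD leeD// integral_spike_pos.
Qed.

(** Lebesgue measure is determined by its values on bounded half-open intervals, so invariance has
    to be checked only there. *)
Lemma lebesgue_measure_translation (c : R) (A : set R) : measurable A ->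
  pushforward mu (fun x : measurableTypeR R => x + c : measurableTypeR R) A = mu A.
Proof.
move=> mA; apply/esym; apply: lebesgue_measure_unique => //.
  by apply: measurable_funD; [exact: measurable_id|exact: measurable_cst].
move=> mc _ [[a b]] _ <-; transitivity (mu `]a - c, b - c]%classic).
  rewrite !lebesgue_measure_itv/= !lte_fin ltrD2r.
  by case: ifP => // _; rewrite -!EFinB; congr EFin; ring.
rewrite /=/pushforward; congr (mu _); apply/seteqP.
by split => x /=; rewrite !in_itv/= ltrBlDr lerBrDr.
Qed.

Lemma ge0_integral_translation (c : R) (f : R -> \bar R) :
  measurable_fun [set: R] f -> (forall x, 0 <= f x)%E ->
  (\int[mu]_x f (x + c)%R = \int[mu]_x f x)%E.
Proof.
move=> mf f0.
have mc : measurable_fun [set: R] (fun x : measurableTypeR R => x + c : measurableTypeR R).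
  by apply: measurable_funD; [exact: measurable_id|exact: measurable_cst].
have := @ge0_integral_pushforward _ _ (measurableTypeR R) (measurableTypeR R) R _ mc mu setT f
  measurableT mf (fun x _ => f0 x).
rewrite preimage_setT => <-.
by apply: eq_measure_integral => //= A mA AS; exact: lebesgue_measure_translation.
Qed.

Lemma integral_spike_center (c : R) : (\int[mu]_x spike (x - c)%R <= 6%:E)%E.
Proof.
rewrite ge0_integral_translation; [|exact: measurable_spike|exact: spike_ge0].
exact: integral_spike.
Qed.

End LineIntegrals.

(** * Integrals over the plane *)

(* For fixed u, the points (u, y) of the washer at depth s below the unit circle have
   [`|y|] within a constant multiple of s from [Num.sqrt (1 - u ^+ 2)], as long as
   [`|u| <= `|y|]; this replaces polar coordinates in all upper bounds. *)
Definition shell {R : realType} (u y : R) : \bar R :=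
  if (-1 <= u) && (u <= 1)
  then (spike (y - Num.sqrt (1 - u ^+ 2)) + spike (y + Num.sqrt (1 - u ^+ 2)))%E
  else 0%E.

(** Either coordinate may be the larger one in absolute value; the sum covers both cases. *)
Definition shells {R : realType} (p : R * R) : \bar R :=
  (shell p.1 p.2 + shell p.2 p.1)%E.

(** * Weighted Tonelli bounds on product spaces *)

Section Tonelli.
Local Open Scope ereal_scope.
Context d1 d2 (T1 : measurableType d1) (T2 : measurableType d2) (R : realType).
Variables (m1 : {sigma_finite_measure set T1 -> \bar R})
  (m2 : {sigma_finite_measure set T2 -> \bar R}) (f : T1 * T2 -> \bar R).
Hypotheses (mf : measurable_fun setT f) (f0 : forall z, 0 <= f z).

(** The weight is constant in the second variable, so that variable is integrated first, with a
    bound [a] uniform in the first. *)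
Lemma tonelli_bound1 (w : T1 -> \bar R) (a b : R) :
  measurable_fun setT w -> (forall x, 0 <= w x) -> (0 <= a)%R ->
  (forall x, \int[m2]_y f (x, y) <= a%:E) -> \int[m1]_x w x <= b%:E ->
  \int[m1 \x m2]_z (w z.1 * f z) <= (a * b)%:E.
Proof.
move=> mw w0 a0 fa wb.
have mwf : measurable_fun setT (fun z => w z.1 * f z).
  by apply: emeasurable_funM => //; exact: measurableT_comp mw measurable_fst.
have wf0 z : 0 <= w z.1 * f z by rewrite mule_ge0.
rewrite fubini_tonelli1// EFinM; apply: (@le_trans _ _ (a%:E * \int[m1]_x w x)); last first.
  by rewrite lee_wpmul2l.
rewrite -ge0_integralZl//; apply: ge0_le_integral => //.
- by move=> x _; exact: integral_ge0.
- exact: measurable_fun_fubini_tonelli_F.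
- exact: measurable_funeM.
move=> x _; rewrite /fubini_F/= ge0_integralZl//; last exact: measurableT_comp mf (measurable_pair1 x).
by rewrite muleC lee_wpmul2r.
Qed.

Lemma tonelli_bound2 (w : T2 -> \bar R) (a b : R) :
  measurable_fun setT w -> (forall x, 0 <= w x) -> (0 <= a)%R ->
  (forall y, \int[m1]_x f (x, y) <= a%:E) -> \int[m2]_y w y <= b%:E ->
  \int[m1 \x m2]_z (w z.2 * f z) <= (a * b)%:E.
Proof.
move=> mw w0 a0 fa wb.
have mwf : measurable_fun setT (fun z => w z.2 * f z).
  by apply: emeasurable_funM => //; exact: measurableT_comp mw measurable_snd.
have wf0 z : 0 <= w z.2 * f z by rewrite mule_ge0.
rewrite fubini_tonelli2// EFinM; apply: (@le_trans _ _ (a%:E * \int[m2]_x w x)); last first.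
  by rewrite lee_wpmul2l.
rewrite -ge0_integralZl//; apply: ge0_le_integral => //.
- by move=> x _; exact: integral_ge0.
- exact: measurable_fun_fubini_tonelli_G.
- exact: measurable_funeM.
move=> x _; rewrite /fubini_G/= ge0_integralZl//; last exact: measurableT_comp mf (measurable_pair2 x).
by rewrite muleC lee_wpmul2r.
Qed.

End Tonelli.

Lemma integralD_lty d (T : measurableType d) (R : realType)
    (m : {measure set T -> \bar R}) (f g : T -> \bar R) :
  measurable_fun setT f -> measurable_fun setT g ->
  (forall x, 0 <= f x)%E -> (forall x, 0 <= g x)%E ->
  (\int[m]_x f x < +oo -> \int[m]_x g x < +oo -> \int[m]_x (f x + g x) < +oo)%E.
Proof. by move=> mf mg f0 g0 fy gy; rewrite ge0_integralD// lte_add_pinfty. Qed.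

(** * Sigma-finiteness of planar area *)

Section PlaneMeasure.
Context {R : realType}.
Local Open Scope ereal_scope.
Local Notation TR := (measurableTypeR R).

(* Mathcomp-analysis shadows the sigma-finite structure of product measures by
   one for products of probabilities, hence this named copy. *)
Definition plane_measure : set (TR * TR) -> \bar R := area R.

HB.instance Definition _ := Measure.on plane_measure.

Let sigma_finite_plane_measure : sigma_finite setT plane_measure.
Proof.
have /sigma_finiteP[F [TF ndF Foo]] := sigma_finiteT (@lebesgue_measure R).
(* A point needs one index per coordinate; as [F] is increasing, the maximum of the two serves
   both. *)
exists (fun n => F n `*` F n).
  rewrite -setXTT TF predeqE => -[x y]; split.
    move=> [/= [n _ Fnx] [k _ Fky]]; exists (maxn n k) => //; split.
    - by move: x Fnx; exact/subsetPset/ndF/leq_maxl.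
    - by move: y Fky; exact/subsetPset/ndF/leq_maxr.
  by move=> [n _ []/= ? ?]; split; exists n.
move=> k; have [? ?] := Foo k.
split; first exact: measurableX.
by rewrite /plane_measure product_measure1E// lte_mul_pinfty// ge0_fin_numE.
Qed.

HB.instance Definition _ := Measure_isSigmaFinite.Build _ _ _ plane_measure
  sigma_finite_plane_measure.

End PlaneMeasure.

(** * Integrals of spikes and shells, and the majorant of the energy density *)

Section PlaneIntegrals.
Context {R : realType}.
Local Notation mu := (@lebesgue_measure R).
Local Notation nu := (@plane_measure R).
Local Open Scope ereal_scope.

Lemma measurable_spike_comp d (T : measurableType d) (f : T -> R) :
  measurable_fun setT f -> measurable_fun setT (fun x => spike (f x)).
Proof. exact: measurableT_comp measurable_spike. Qed.

Lemma measurable_shell_comp d (T : measurableType d) (f g : T -> R) :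
  measurable_fun setT f -> measurable_fun setT g ->
  measurable_fun setT (fun x => shell (f x) (g x)).
Proof.
move=> mf mg.
have mh : measurable_fun setT (fun x => Num.sqrt (1 - f x ^+ 2)).
  apply: (measurableT_comp (continuous_measurable_fun (@sqrt_continuous R))) => /=.
  by apply: measurable_funB; [exact: measurable_cst|exact: measurable_funX].
apply: measurable_fun_ifT; last exact: measurable_cst.
  by apply: measurable_and; apply: measurable_fun_ler => //; exact: measurable_cst.
by apply: emeasurable_funD; apply: measurable_spike_comp;
  [exact: measurable_funB|exact: measurable_funD].
Qed.

Lemma shell_ge0 (u y : R) : 0 <= shell u y.
Proof. by rewrite /shell; case: ifP => // _; rewrite adde_ge0// spike_ge0. Qed.

Lemma measurable_shells : measurable_fun setT (@shells R).
Proof. by apply: emeasurable_funD; apply: measurable_shell_comp. Qed.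

Lemma shells_ge0 (p : R * R) : 0 <= shells p.
Proof. by rewrite adde_ge0// shell_ge0. Qed.

Lemma integral_shell_line (u : R) : \int[mu]_y shell u y <= 12%:E.
Proof.
rewrite /shell; case: (_ && _)%B; last by rewrite integral0 lee_fin.
rewrite ge0_integralD//; try by move=> x _; exact: spike_ge0.
- rewrite (_ : 12 = 6 + 6 :> R)%R; last by ring.
  rewrite EFinD leeD ?integral_spike_center//.
  under eq_integral => y _ do rewrite -[Num.sqrt _]opprK.
  exact: integral_spike_center.
- by apply: measurable_spike_comp; apply: measurable_funB.
- by apply: measurable_spike_comp; apply: measurable_funD.
Qed.

(** Integrating in the second coordinate first uses up the shell, with a bound independent of the
    first coordinate; only the spike is left. *)
Lemma integral_shell_spike (c : R) :
  \int[nu]_p (spike (p.1 - c) * shell p.1 p.2) <= 72%:E.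
Proof.
rewrite (_ : 72 = 12 * 6 :> R)%R; last by ring.
apply: (@tonelli_bound1 _ _ _ _ R mu mu (fun p => shell p.1 p.2) _ _ (fun x => spike (x - c))) => //.
- exact: measurable_shell_comp.
- by move=> z; exact: shell_ge0.
- by apply: measurable_spike_comp; apply: measurable_funB.
- by move=> x; exact: spike_ge0.
- exact: integral_shell_line.
- exact: integral_spike_center.
Qed.

Lemma integral_shell_spike_swap (c : R) :
  \int[nu]_p (spike (p.2 - c) * shell p.2 p.1) <= 72%:E.
Proof.
rewrite (_ : 72 = 12 * 6 :> R)%R; last by ring.
apply: (@tonelli_bound2 _ _ _ _ R mu mu (fun p => shell p.2 p.1) _ _ (fun x => spike (x - c))) => //.
- exact: measurable_shell_comp.
- by move=> z; exact: shell_ge0.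
- by apply: measurable_spike_comp; apply: measurable_funB.
- by move=> x; exact: spike_ge0.
- exact: integral_shell_line.
- exact: integral_spike_center.
Qed.

Lemma integral_spike_spike (c : R * R) :
  \int[nu]_p (spike (p.1 - c.1) * spike (p.2 - c.2)) <= 36%:E.
Proof.
rewrite (_ : 36 = 6 * 6 :> R)%R; last by ring.
apply: (@tonelli_bound1 _ _ _ _ R mu mu (fun p => spike (p.2 - c.2)) _ _ (fun x => spike (x - c.1))) => //.
- by apply: measurable_spike_comp; apply: measurable_funB.
- by move=> z; exact: spike_ge0.
- by apply: measurable_spike_comp; apply: measurable_funB.
- by move=> x; exact: spike_ge0.
- by move=> x; exact: integral_spike_center.
- exact: integral_spike_center.
Qed.

(** The bound on [shell] along lines is uniform in u but not integrable over all u; this indicator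
    of [-1, 1], which [shell] absorbs, serves as the outer weight. *)
Let unit_window (u : R) : \bar R := if ((-1 <= u) && (u <= 1))%R then 1 else 0.

Let measurable_window : measurable_fun setT unit_window.
Proof.
apply: measurable_fun_ifT => //.
by apply: measurable_and; apply: measurable_fun_ler => //; exact: measurable_cst.
Qed.

Let window_ge0 u : 0 <= unit_window u. Proof. by rewrite /unit_window; case: ifP. Qed.

Let integral_window : \int[mu]_u unit_window u <= 2%:E.
Proof.
rewrite (_ : unit_window = (cst 1) \_ `[(-1)%R, 1%R]); last first.
  apply/funext => u; rewrite patchE /unit_window.
  by case: ifP => H; [rewrite mem_set//= in_itv|rewrite memNset//= in_itv/= H].
rewrite -integral_mkcond integral_cst//= lebesgue_measure_itv/= lte_fin mul1e.
by rewrite ifT ?lee_fin; lra.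
Qed.

Let windowM u y : unit_window u * shell u y = shell u y.
Proof. by rewrite /unit_window /shell; case: ifP; rewrite ?mul1e ?mul0e. Qed.

Lemma integral_shells : \int[nu]_p shells p <= 48%:E.
Proof.
rewrite ge0_integralD//; try by move=> x _; exact: shell_ge0.
- rewrite (_ : 48 = 12 * 2 + 12 * 2 :> R)%R; last by ring.
  rewrite EFinD leeD//.
  + under eq_integral do rewrite -windowM.
    apply: (@tonelli_bound1 _ _ _ _ R mu mu (fun p => shell p.1 p.2) _ _ unit_window) => //.
    * exact: measurable_shell_comp.
    * by move=> z; exact: shell_ge0.
    * exact: integral_shell_line.
  + under eq_integral do rewrite -windowM.
    apply: (@tonelli_bound2 _ _ _ _ R mu mu (fun p => shell p.2 p.1) _ _ unit_window) => //.
    * exact: measurable_shell_comp.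
    * by move=> z; exact: shell_ge0.
    * exact: integral_shell_line.
- exact: measurable_shell_comp.
- exact: measurable_shell_comp.
Qed.

(** Let z = (p, q). The first two terms serve the case where |p - q| dominates the depths: a spike
    in one coordinate of p - q bounds the weight of the distance, and the shell of p is integrated
    in the other coordinate. The last two serve comparable depths, with the deeper point at p or at
    q. *)
Definition majorant (z : (R * R) * (R * R)) : \bar R :=
  shells z.2 * (spike (z.1.1 - z.2.1) * shell z.1.1 z.1.2)
  + shells z.2 * (spike (z.1.2 - z.2.2) * shell z.1.2 z.1.1)
  + (shells z.1 * (spike (z.1.1 - z.2.1) * spike (z.1.2 - z.2.2))
    + shells z.2 * (spike (z.1.1 - z.2.1) * spike (z.1.2 - z.2.2))).

Let m11 : measurable_fun setT (fun z : (R * R) * (R * R) => z.1.1).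
Proof. exact: measurableT_comp measurable_fst measurable_fst. Qed.
Let m12 : measurable_fun setT (fun z : (R * R) * (R * R) => z.1.2).
Proof. exact: measurableT_comp measurable_snd measurable_fst. Qed.
Let m21 : measurable_fun setT (fun z : (R * R) * (R * R) => z.2.1).
Proof. exact: measurableT_comp measurable_fst measurable_snd. Qed.
Let m22 : measurable_fun setT (fun z : (R * R) * (R * R) => z.2.2).
Proof. exact: measurableT_comp measurable_snd measurable_snd. Qed.

Let ma : measurable_fun setT (fun z : (R * R) * (R * R) => spike (z.1.1 - z.2.1)).
Proof. by apply: measurable_spike_comp; exact: measurable_funB. Qed.
Let mb : measurable_fun setT (fun z : (R * R) * (R * R) => spike (z.1.2 - z.2.2)).
Proof. by apply: measurable_spike_comp; exact: measurable_funB. Qed.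
Let ms1 : measurable_fun setT (fun z : (R * R) * (R * R) => shells z.1).
Proof. exact: measurableT_comp measurable_shells measurable_fst. Qed.
Let ms2 : measurable_fun setT (fun z : (R * R) * (R * R) => shells z.2).
Proof. exact: measurableT_comp measurable_shells measurable_snd. Qed.

Let msa : measurable_fun setT (fun z : (R * R) * (R * R) => spike (z.1.1 - z.2.1) * shell z.1.1 z.1.2).
Proof. by apply: emeasurable_funM; [exact: ma|exact: measurable_shell_comp]. Qed.
Let msb : measurable_fun setT (fun z : (R * R) * (R * R) => spike (z.1.2 - z.2.2) * shell z.1.2 z.1.1).
Proof. by apply: emeasurable_funM; [exact: mb|exact: measurable_shell_comp]. Qed.
Let mab : measurable_fun setT (fun z : (R * R) * (R * R) => spike (z.1.1 - z.2.1) * spike (z.1.2 - z.2.2)).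
Proof. exact: emeasurable_funM ma mb. Qed.

Lemma measurable_majorant : measurable_fun setT majorant.
Proof.
exact: (emeasurable_funD (emeasurable_funD (emeasurable_funM ms2 msa)
  (emeasurable_funM ms2 msb)) (emeasurable_funD (emeasurable_funM ms1 mab)
  (emeasurable_funM ms2 mab))).
Qed.

Lemma majorant_ge0 z : 0 <= majorant z.
Proof.
by rewrite /majorant !adde_ge0// mule_ge0 ?shells_ge0// mule_ge0 ?spike_ge0 ?shell_ge0.
Qed.

(** In each term one point is integrated with the other fixed, with the uniform bound 72 or 36; the
    remaining factor [shells] has integral at most 48. *)
Lemma integral_majorant : \int[(nu \x nu)]_z majorant z < +oo.
Proof.
have sa0 (u v w : R) : 0 <= spike u * shell v w by rewrite mule_ge0 ?spike_ge0 ?shell_ge0.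
have sb0 (u v : R) : 0 <= spike u * spike v by rewrite mule_ge0 ?spike_ge0.
have T1 := @tonelli_bound2 _ _ _ _ R nu nu _ msa (fun z => sa0 _ _ _) _ 72%R _
  measurable_shells shells_ge0 _ _ integral_shells.
have T2 := @tonelli_bound2 _ _ _ _ R nu nu _ msb (fun z => sa0 _ _ _) _ 72%R _
  measurable_shells shells_ge0 _ _ integral_shells.
have T3 := @tonelli_bound1 _ _ _ _ R nu nu _ mab (fun z => sb0 _ _) _ 36%R _
  measurable_shells shells_ge0 _ _ integral_shells.
have T4 := @tonelli_bound2 _ _ _ _ R nu nu _ mab (fun z => sb0 _ _) _ 36%R _
  measurable_shells shells_ge0 _ _ integral_shells.
have mA := emeasurable_funM ms2 msa; have mB := emeasurable_funM ms2 msb.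
have mC := emeasurable_funM ms1 mab; have mD := emeasurable_funM ms2 mab.
have IL := @integralD_lty _ _ R (nu \x nu).
have A0 z := mule_ge0 (shells_ge0 z.2) (sa0 (z.1.1 - z.2.1)%R z.1.1 z.1.2).
have B0 z := mule_ge0 (shells_ge0 z.2) (sa0 (z.1.2 - z.2.2)%R z.1.2 z.1.1).
have C0 z := mule_ge0 (shells_ge0 z.1) (sb0 (z.1.1 - z.2.1)%R (z.1.2 - z.2.2)%R).
have D0 z := mule_ge0 (shells_ge0 z.2) (sb0 (z.1.1 - z.2.1)%R (z.1.2 - z.2.2)%R).
apply: (IL _ _ (emeasurable_funD mA mB) (emeasurable_funD mC mD)
  (fun z => adde_ge0 (A0 z) (B0 z)) (fun z => adde_ge0 (C0 z) (D0 z))).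
- apply: (IL _ _ mA mB A0 B0).
  + by apply: le_lt_trans (T1 _ _) (ltry _) => //= q; exact: integral_shell_spike.
  + by apply: le_lt_trans (T2 _ _) (ltry _) => //= q; exact: integral_shell_spike_swap.
- apply: (IL _ _ mC mD C0 D0).
  + apply: le_lt_trans (T3 _ _) (ltry _) => //= q.
    (* The second point is now the integration variable; evenness of [spike] reverses the
       differences. *)
    under eq_integral => x _ do rewrite -(spikeN (q.1 - _)) -(spikeN (q.2 - _)) !opprB.
    exact: integral_spike_spike.
  + by apply: le_lt_trans (T4 _ _) (ltry _) => //= q; exact: integral_spike_spike.
Qed.

End PlaneIntegrals.

(** * Geometry of the washer *)

Definition rad {R : realType} (p : R * R) : R := Num.sqrt (p.1 ^+ 2 + p.2 ^+ 2).

Definition annulus {R : realType} : set (R * R) := [set p | 1 / 2 <= rad p < 1].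

Lemma densE {R : realType} (x : R) : dens x = (x * ell x ^+ 4)^-1. Proof. by []. Qed.

Opaque ell dens.

Section Geometry.
Context {R : realType}.
Implicit Types p q : R * R.

Lemma rad_ge0 p : 0 <= rad p. Proof. exact: sqrtr_ge0. Qed.

Lemma rad_sqr p : rad p ^+ 2 = p.1 ^+ 2 + p.2 ^+ 2.
Proof. by rewrite sqr_sqrtr// addr_ge0 ?sqr_ge0. Qed.

Lemma enorm_plane p : enorm (plane p) = rad p.
Proof.
rewrite /enorm /dot !big_ord_recl big_ord0 !mxE /=.
by rewrite mulr0 !addr0 -!expr2.
Qed.

Lemma planeB p q : plane p - plane q = plane (p - q).
Proof.
by apply/rowP => -[[|[|[|//]]] ilt]; rewrite !mxE //= subr0.
Qed.

Lemma normr1_rad p : `|p.1| <= rad p.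
Proof.
rewrite -(@ler_pXn2r _ 2) ?nnegrE ?rad_ge0//.
by rewrite rad_sqr real_normK ?num_real// lerDl sqr_ge0.
Qed.

Lemma normr2_rad p : `|p.2| <= rad p.
Proof.
rewrite -(@ler_pXn2r _ 2) ?nnegrE ?rad_ge0//.
by rewrite rad_sqr real_normK ?num_real// lerDr sqr_ge0.
Qed.

Lemma cauchy_schwarz p q : `|p.1 * q.1 + p.2 * q.2| <= rad p * rad q.
Proof.
rewrite -(@ler_pXn2r _ 2) ?nnegrE ?mulr_ge0 ?rad_ge0//.
rewrite exprMn !rad_sqr real_normK ?num_real// -subr_ge0.
rewrite (_ : _ - _ = (p.1 * q.2 - p.2 * q.1) ^+ 2) ?sqr_ge0//; ring.
Qed.

Lemma rad_triangle p q : rad (p + q) <= rad p + rad q.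
Proof.
rewrite -(@ler_pXn2r _ 2) ?nnegrE ?addr_ge0 ?rad_ge0//.
have := le_trans (ler_norm _) (cauchy_schwarz p q).
rewrite (rad_sqr (p + q)) (sqrrD (rad p)) !rad_sqr /=; lra.
Qed.

Lemma radN p : rad (- p) = rad p.
Proof. by rewrite /rad /= !sqrrN. Qed.

Lemma rad_dist p q : `|rad p - rad q| <= rad (p - q).
Proof.
have H1 : rad p <= rad (p - q) + rad q by have := rad_triangle (p - q) q; rewrite subrK.
have : rad q <= rad (q - p) + rad p by have := rad_triangle (q - p) p; rewrite subrK.
have -> : rad (q - p) = rad (p - q) by rewrite /rad /= -(sqrrN (q.1 - p.1)) -(sqrrN (q.2 - p.2)) !opprB.
move=> H2.
by rewrite ler_norml; lra.
Qed.

Lemma polar p : 0 < rad p ->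
  exists2 phi, - pi <= phi < pi & p = (rad p * cos phi, rad p * sin phi).
Proof.
move=> r0; pose c := p.1 / rad p.
have c1 : -1 <= c <= 1.
  rewrite -ler_norml normrM normfV (gtr0_norm r0) ler_pdivrMr// mul1r.
  exact: normr1_rad.
have sc : sin (acos c) = `|p.2| / rad p.
  rewrite sin_acos// -[RHS]ger0_norm ?divr_ge0 ?rad_ge0// -sqrtr_sqr; congr Num.sqrt.
  rewrite !exprMn exprVn real_normK ?num_real//.
  have := rad_sqr p; have : rad p != 0 by rewrite gt_eqF.
  move=> rn rE; rewrite (_ : p.2 ^+ 2 = rad p ^+ 2 - p.1 ^+ 2); last by rewrite rE; ring.
  by field.
have [a0 api] : 0 <= acos c /\ acos c <= pi by rewrite acos_ge0 ?acos_lepi.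
have cE : rad p * c = p.1 by rewrite mulrC divfK ?gt_eqF.
(* The angle pi is excluded, so p.2 = 0 belongs to the branch - acos: the negative half axis gets
   the angle -pi. *)
have [p20|p20] := ltP 0 p.2.
  exists (acos c).
    rewrite (le_trans _ a0) ?oppr_le0 ?pi_ge0//=.
    rewrite lt_neqAle api andbT; apply/eqP => apiE.
    by move: sc; rewrite apiE sinpi gtr0_norm// => /esym/eqP; rewrite mulf_eq0 invr_eq0 !gt_eqF.
  by rewrite acosK// cE sc gtr0_norm// mulrCA divff ?gt_eqF// mulr1; case: (p).
exists (- acos c).
  by rewrite lerN2 api (le_lt_trans _ (pi_gt0 _))// oppr_le0.
rewrite cosN sinN acosK// cE sc ler0_norm// mulNr opprK mulrCA divff ?gt_eqF// mulr1.
by case: (p).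
Qed.

Lemma wash_plane p : wash (plane p) <-> annulus p.
Proof.
split=> [[r [phi [rr _ E]]]|rr]; rewrite /annulus/=.
  suff -> : rad p = r by [].
  have r0 : 0 <= r by case/andP: rr => + _; apply: le_trans; lra.
  have /rowP E' := E.
  have := E' (Ordinal (isT : (0 < 3)%N)); have := E' (Ordinal (isT : (1 < 3)%N)).
  rewrite /plane !mxE/= /rad => -> ->.
  by rewrite !exprMn -mulrDr cos2Dsin2 mulr1 sqrtr_sqr ger0_norm.
have r0 : 0 < rad p by case/andP: rr => + _; apply: lt_le_trans; lra.
by have [phi phir E] := polar p r0; exists (rad p), phi; split => //; rewrite {1}E.
Qed.

Lemma preimage_wash : plane @^-1` wash = annulus :> set (R * R).
Proof. by apply/seteqP; split => p /=; rewrite wash_plane. Qed.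

Lemma measurable_rad d (T : measurableType d) (f : T -> R * R) :
  measurable_fun setT (fst \o f) -> measurable_fun setT (snd \o f) ->
  measurable_fun setT (rad \o f).
Proof.
move=> m1 m2; apply: (measurableT_comp (continuous_measurable_fun (@sqrt_continuous R))) => /=.
by apply: measurable_funD; apply: measurable_funX.
Qed.

Lemma measurable_annulus : measurable (annulus : set (R * R)).
Proof.
have mr : measurable_fun setT (@rad R).
  by apply: (@measurable_rad _ _ id); [exact: measurable_fst|exact: measurable_snd].
have := mr measurableT _ (measurable_itv `[1 / 2, 1[%R).
by rewrite setTI; congr measurable; apply/seteqP; split => p /=; rewrite in_itv.
Qed.

(** With h = sqrt(1 - p.1^2) and r = [rad p], (1 - r)(1 + r) = (h - |p.2|)(h + |p.2|). Since |p.1|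
    <= |p.2| forces h >= 1/2, and 1 + r <= 2, the depth 1 - r is at least (h - |p.2|)/4. The sign of
    p.2 decides which spike of the shell applies. *)
Lemma shell_dens p : annulus p -> `|p.1| <= `|p.2| ->
  ((dens (1 - rad p))%:E <= 4%:E * shell p.1 p.2)%E.
Proof.
move=> /andP[r1 r2] p12.
have := rad_sqr p; have r0 := rad_ge0 p; set r := rad p in r1 r2 r0 *.
have sq12 : p.1 ^+ 2 <= p.2 ^+ 2.
  by rewrite -(real_normK (num_real p.1)) -(real_normK (num_real p.2)) lerXn2r ?nnegrE.
have r21 : r ^+ 2 < 1 by rewrite expr_lt1.
move=> rE; have p1 : p.1 ^+ 2 <= 1 / 2 by lra.
have h0 := sqrtr_ge0 (1 - p.1 ^+ 2).
have hE : Num.sqrt (1 - p.1 ^+ 2) ^+ 2 = 1 - p.1 ^+ 2 by rewrite sqr_sqrtr//; lra.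
rewrite /shell; set h := Num.sqrt _ in h0 hE *.
have -> : (-1 <= p.1) && (p.1 <= 1).
  rewrite -ler_norml -(@ler_pXn2r _ 2) ?nnegrE// real_normK ?num_real// expr1n; lra.
have h12 : 1 / 2 <= h.
  by rewrite -(@ler_pXn2r _ 2) ?nnegrE// hE; lra.
have h1 : h <= 1.
  by rewrite -(@ler_pXn2r _ 2) ?nnegrE// hE expr1n; have := sqr_ge0 p.1; lra.
have p2E : `|p.2| ^+ 2 = p.2 ^+ 2 by rewrite real_normK ?num_real.
have hp : `|p.2| < h.
  by rewrite -(@ltr_pXn2r _ 2) ?nnegrE// hE p2E; lra.
pose sg := h - `|p.2|.
have sg0 : 0 < sg by rewrite subr_gt0.
have sg1 : sg <= 1 by rewrite /sg; have := normr_ge0 p.2; lra.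
have ssg : sg / 4 <= 1 - r.
  have : (1 - r) * (1 + r) = sg * (h + `|p.2|).
    by rewrite /sg -!subr_sqr expr1n hE p2E rE; ring.
  have := normr_ge0 p.2; rewrite /sg => ? ?; nra.
(* Quartering the argument costs at most a factor 4, since [ell] is decreasing and its fourth power
   stands in the denominator. *)
have dsg : dens (1 - r) <= 4 * dens sg.
  have s4 : 0 < sg / 4 by rewrite divr_gt0.
  have s41 : sg / 4 <= sg by clear -sg0; lra.
  have s2 : sg <= 2 by clear -sg1; lra.
  have r22 : 1 - r <= 2 by clear -r0; lra.
  have es : 0 < ell sg by apply: ell_gt0; rewrite sg0.
  have e4 : 0 < ell (sg / 4) by apply: ell_gt0; rewrite s4 (le_trans s41).
  apply: (@le_trans _ _ (dens (sg / 4))); first exact: dens_le.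
  have e : ell sg <= ell (sg / 4) by exact: ell_le.
  rewrite densE (densE sg); move: (ell sg) (ell (sg / 4)) es e4 e => u v es e4 e.
  apply: ler_invM; rewrite ?mulr_gt0 ?exprn_gt0//.
  have -> : 4 * (sg / 4 * v ^+ 4) = sg * v ^+ 4 by field.
  by rewrite ler_pM2l//; apply: lerXn2r; rewrite ?nnegrE ?(ltW es) ?(ltW e4).
apply: (@le_trans _ _ (4%:E * (dens sg)%:E)%E); first by rewrite -EFinM lee_fin.
rewrite lee_wpmul2l//.
have spE : spike sg = (dens sg)%:E by rewrite spikeE// sg0; clear -sg1; lra.
have [p20|p20] := leP 0 p.2.
  have -> : p.2 - h = - sg by rewrite /sg ger0_norm//; ring.
  by rewrite spikeN spE leeDl// spike_ge0.
have -> : p.2 + h = sg by rewrite /sg ltr0_norm//; ring.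
by rewrite spE leeDr// spike_ge0.
Qed.

Lemma shells_dens p : annulus p -> ((dens (1 - rad p))%:E <= 4%:E * shells p)%E.
Proof.
move=> ap; have [p12|p12] := leP `|p.1| `|p.2|.
  by rewrite (le_trans (shell_dens p ap p12))// lee_wpmul2l// leeDl// shell_ge0.
have radE : rad (p.2, p.1) = rad p by rewrite /rad /= addrC.
have ap' : annulus (p.2, p.1) by rewrite /annulus/= radE.
have := shell_dens (p.2, p.1) ap' (ltW p12); rewrite radE => /le_trans; apply.
by rewrite lee_wpmul2l// leeDr// shell_ge0.
Qed.

(** At depth s = 1 - r <= 1/2 the logarithm ln(1/s) is at least 1/2, so 4 + ln(1/s) <= 9 ln(1/s);
    squaring gives 81. *)
Lemma lambda_le (r : R) : 1 / 2 <= r < 1 ->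
  0 <= lambda r <= 81 * ((1 - r) * ell (1 - r) ^+ 6)^-1.
Proof.
move=> /andP[r1 r2]; have s0 : 0 < 1 - r by lra.
have sr : 0 < 1 - r <= 2 by lra.
have es := ell_gt0 _ sr.
rewrite /lambda invr_ge0 mulr_ge0 ?sqr_ge0 ?(ltW s0)//=.
have l0 : 1 / 2 <= ln (1 - r)^-1.
  have : ln (1 - (1 / 2)) <= - (1 / 2) :> R by apply: le_ln1Dx; lra.
  have : ln (1 - r) <= ln (1 - 1 / 2) by rewrite ler_ln ?posrE; lra.
  by rewrite lnV ?posrE//; lra.
have l1 : 0 < ln (1 - r)^-1 by lra.
apply: ler_invM; rewrite ?mulr_gt0 ?exprn_gt0//.
rewrite (exprM _ 3 2) ell_cube// -[- ln _]lnV ?posrE//.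
rewrite (mulrCA 81) ler_pM2l//; nra.
Qed.

Lemma near_sum_le (x y u v w : R) : 0 <= x -> 0 <= y -> 0 <= u -> 0 <= v -> 0 <= w ->
  2 * (x * y * u) <= 16 * (v * u * w + (u + w) * (x * y)).
Proof.
move=> x0 y0 u0 v0 w0.
have : 0 <= v * u * w by rewrite !mulr_ge0.
have : 0 <= x * y * u by rewrite !mulr_ge0.
have : 0 <= x * y * w by rewrite !mulr_ge0.
by clear; lra.
Qed.

(* a and b are the coordinates of a difference of length d, and s, t are the depths of its
   endpoints: either the deeper depth is at most 2d, or s and t are comparable. *)
Lemma kernel_bound (a b s t d : R) : 0 < s <= 1 -> 0 < t <= 1 ->
  `|a| <= d -> `|b| <= d -> `|s - t| <= d -> 0 < d <= 2 ->
  (((s * ell s ^+ 6)^-1 * (t * ell t ^+ 6)^-1 * d^-1)%:E <=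
   16%:E * ((dens d)%:E * (dens s)%:E * (dens t)%:E
     + ((dens s)%:E + (dens t)%:E) * (spike a * spike b)))%E.
Proof.
wlog ts : s t / t <= s.
  move=> W sr tr ad bd std dr; have [ts|/ltW st] := leP t s; first exact: W.
  have := W t s st tr sr ad bd; rewrite distrC => /(_ std dr).
  by rewrite (mulrC (t * _)^-1) (addeC (dens t)%:E) (muleAC (dens d)%:E).
move=> /andP[s0 s1] /andP[t0 t1] ad bd std /andP[d0 d2].
have s2 : 0 < s <= 2 by lra.
have t2 : 0 < t <= 2 by lra.
have dr : 0 < d <= 2 by lra.
have ds := dens_gt0 _ s2; have dt := dens_gt0 _ t2; have dd := dens_gt0 _ dr.
have [sd|sd] := leP s (2 * d).
  apply: (@le_trans _ _ (16 * (dens d * dens s * dens t))%:E).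
    by rewrite lee_fin; apply: kernel_bound_far.
  rewrite EFinM lee_wpmul2l// !EFinM; apply: leeDl; apply: mule_ge0.
    by apply: adde_ge0; rewrite lee_fin ltW.
  by apply: mule_ge0; exact: spike_ge0.
have st : s <= 2 * t.
  by move: std; rewrite ler_norml => /andP[_]; clear -sd; lra.
(* A vanishing coordinate makes its spike +oo, and the other spike is positive by [ge_spike], so the
   right-hand side is +oo. *)
have infinite : (spike a * spike b = +oo)%E -> (((s * ell s ^+ 6)^-1 * (t * ell t ^+ 6)^-1 * d^-1)%:E <=
   16%:E * ((dens d)%:E * (dens s)%:E * (dens t)%:E
     + ((dens s)%:E + (dens t)%:E) * (spike a * spike b)))%E.
  move=> ->; rewrite gt0_muley; last by rewrite adde_gt0 ?lte_fin.
  by rewrite addey ?gt0_muley ?leey ?lte_fin ?ltr0n// -!EFinM.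
have [a0|a0] := eqVneq a 0; last have [b0|b0] := eqVneq b 0; first 2 last.
- have na : 0 < `|a| by rewrite normr_gt0.
  have nb : 0 < `|b| by rewrite normr_gt0.
  have -> : spike a = (dens `|a|)%:E by rewrite /spike (negbTE a0) (le_trans ad).
  have -> : spike b = (dens `|b|)%:E by rewrite /spike (negbTE b0) (le_trans bd).
  have da : 0 < dens `|a| by apply: dens_gt0; rewrite na (le_trans ad d2).
  have db : 0 < dens `|b| by apply: dens_gt0; rewrite nb (le_trans bd d2).
  rewrite (_ : (16%:E * _)%E = (16 * (dens d * dens s * dens t
    + (dens s + dens t) * (dens `|a| * dens `|b|)))%:E); last by rewrite !(EFinM, EFinD).
  rewrite lee_fin.
  have d0s : d <= s by clear -d0 sd; lra.
  apply: (le_trans (kernel_bound_near `|a| `|b| d s t na ad nb bd d0s st ts s1)).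
  exact: near_sum_le (ltW da) (ltW db) (ltW ds) (ltW dd) (ltW dt).
- apply: infinite; rewrite a0 {1}/spike eqxx gt0_mulye//; apply: lt_le_trans (ge_spike b d bd dr).
  by rewrite lte_fin.
- apply: infinite; rewrite b0 {2}/spike eqxx gt0_muley//; apply: lt_le_trans (ge_spike a d ad dr).
  by rewrite lte_fin.
Qed.

(** Here a, b stand for the spikes of the coordinate differences, u, v for the two shells of p, x, y
    for [shells] at p and q, and ds, dt, dd for the weights of the depths and the distance. In the
    first product each depth contributes a 4, hence 16. *)
Lemma majorant_combine (a b u v x y ds dt dd : \bar R) :
  (0 <= a -> 0 <= b -> 0 <= u -> 0 <= v -> 0 <= x -> 0 <= y ->
   0 <= ds -> 0 <= dt -> 0 <= dd -> dd <= a -> dd <= b ->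
   ds <= 4%:E * u \/ ds <= 4%:E * v -> ds <= 4%:E * x -> dt <= 4%:E * y ->
   dd * ds * dt + (ds + dt) * (a * b) <=
   16%:E * (y * (a * u) + y * (b * v) + (x * (a * b) + y * (a * b))))%E.
Proof.
move=> a0 b0 u0 v0 x0 y0 ds0 dt0 dd0 da db duv dx dy.
have au := mule_ge0 a0 u0; have bv := mule_ge0 b0 v0; have ab := mule_ge0 a0 b0.
have yau := mule_ge0 y0 au; have ybv := mule_ge0 y0 bv.
have xab := mule_ge0 x0 ab; have yab := mule_ge0 y0 ab.
have le416 : (4%:E <= 16%:E :> \bar R)%E by rewrite lee_fin ler_nat.
have p4 : (0 <= 4%:E :> \bar R)%E by rewrite lee_fin.
have E16 : 16%:E = (4%:E * 4%:E)%E :> \bar R by rewrite -EFinM; congr EFin; ring.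
have AC (r s t k : \bar R) : (r * (k * s) * (k * t) = k * k * (t * (r * s)))%E.
  by rewrite (muleCA r k s) muleACA (muleC (r * s)%E).
rewrite (ge0_muleDr 16%:E (adde_ge0 yau ybv) (adde_ge0 xab yab)); apply: leeD.
  case: duv => dsu.
    apply: (@le_trans _ _ (16%:E * (y * (a * u)))%E); last first.
      by apply: lee_wpmul2l; [rewrite lee_fin|exact: leeDl].
    rewrite E16 -AC; apply: (lee_pmul (mule_ge0 dd0 ds0) dt0 _ dy).
    exact: (lee_pmul dd0 ds0 da dsu).
  apply: (@le_trans _ _ (16%:E * (y * (b * v)))%E); last first.
    by apply: lee_wpmul2l; [rewrite lee_fin|exact: leeDr].
  rewrite E16 -AC; apply: (lee_pmul (mule_ge0 dd0 ds0) dt0 _ dy).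
  exact: (lee_pmul dd0 ds0 db dsu).
rewrite -(ge0_muleDl (a * b)%E x0 y0) muleA; apply: (lee_wpmul2r ab).
rewrite (ge0_muleDr 16%:E x0 y0); apply: leeD.
  by apply: (le_trans dx); exact: lee_wpmul2r.
by apply: (le_trans dy); exact: lee_wpmul2r.
Qed.

Lemma lambda_kernel_bound p q : annulus p -> annulus q -> 0 < rad (p - q) ->
  ((lambda (rad p) * lambda (rad q) / rad (p - q))%:E <=
   (81 * 81)%:E * (16%:E * (16%:E * majorant (p, q))))%E.
Proof.
move=> ap aq d0; have /andP[p1 p2] := ap; have /andP[q1 q2] := aq.
have d2 : rad (p - q) <= 2.
  by have := rad_triangle p (- q); rewrite radN; clear -p2 q2; lra.
have ad := normr1_rad (p - q); have bd := normr2_rad (p - q).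
have std : `|(1 - rad p) - (1 - rad q)| <= rad (p - q).
  by rewrite (_ : _ - _ = - (rad p - rad q)) ?normrN ?rad_dist//; ring.
have /andP[lp0 lp] := lambda_le _ ap; have /andP[lq0 lq] := lambda_le _ aq.
have sr : 0 < 1 - rad p <= 1 by clear -p1 p2; lra.
have tr : 0 < 1 - rad q <= 1 by clear -q1 q2; lra.
have dr : 0 < rad (p - q) <= 2 by rewrite d0.
have KB := kernel_bound _ _ _ _ _ sr tr ad bd std dr.
set s := 1 - rad p in sr lp std KB *; set t := 1 - rad q in tr lq std KB *.
set d := rad (p - q) in d0 d2 ad bd std dr KB *.
apply: (@le_trans _ _ ((81 * 81) * ((s * ell s ^+ 6)^-1 * (t * ell t ^+ 6)^-1 * d^-1))%:E).
  rewrite lee_fin mulrA; apply: ler_wpM2r; first by rewrite invr_ge0 ltW.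
  by rewrite mulrACA; exact: ler_pM lp0 lq0 lp lq.
rewrite (EFinM (81 * 81)); apply: lee_wpmul2l; first by rewrite lee_fin.
apply: (le_trans KB); rewrite lee_wpmul2l//.
have sr2 : 0 < s <= 2 by clear -sr; lra.
have tr2 : 0 < t <= 2 by clear -tr; lra.
have ds0 : (0 <= (dens s)%:E)%E by rewrite lee_fin (ltW (dens_gt0 _ sr2)).
have dt0 : (0 <= (dens t)%:E)%E by rewrite lee_fin (ltW (dens_gt0 _ tr2)).
have dd0 : (0 <= (dens d)%:E)%E by rewrite lee_fin (ltW (dens_gt0 _ dr)).
have Ha := ge_spike _ _ ad dr; have Hb := ge_spike _ _ bd dr.
have Sq := shells_dens q aq; have Sp := shells_dens p ap.
apply: (majorant_combine _ _ _ _ _ _ _ _ _ (spike_ge0 _) (spike_ge0 _)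
  (shell_ge0 _ _) (shell_ge0 _ _) (shells_ge0 _) (shells_ge0 _) ds0 dt0 dd0 Ha Hb _ Sp Sq).
(* The spike and the shell are paired through the coordinate of p that is smaller in absolute
   value. *)
have [p12|p12] := leP `|p.1| `|p.2|; [left; exact: shell_dens|right].
have radE : rad (p.2, p.1) = rad p by rewrite /rad /= addrC.
have ap' : annulus (p.2, p.1) by rewrite /annulus/= radE.
by have := shell_dens (p.2, p.1) ap' (ltW p12); rewrite radE.
Qed.

End Geometry.

(** * Energy *)

Section Energy.
Context {R : realType}.
Implicit Types p q : R * R.

Lemma vec3_scale (c x y : R) : c *: vec3 x y 0 = plane (c * x, c * y).
Proof.
by apply/rowP => -[[|[|[|//]]] ilt]; rewrite !mxE //= mulr0.
Qed.

Lemma dot_plane p q : dot (plane p) (plane q) = p.1 * q.1 + p.2 * q.2.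
Proof. by rewrite /dot !big_ord_recl big_ord0 !mxE /= mulr0 !addr0. Qed.

Lemma current_plane J p : wash_current J -> annulus p ->
  J (plane p) = plane (- (lambda (rad p) / rad p * p.2), lambda (rad p) / rad p * p.1).
Proof.
move=> HJ ap; have r0 : 0 < rad p by case/andP: ap => + _; apply: lt_le_trans.
have [phi phir E] := polar p r0.
have -> : plane p = vec3 (rad p * cos phi) (rad p * sin phi) 0 by rewrite {1}E.
rewrite HJ// vec3_scale; congr (plane (_, _)).
  by rewrite {4}E/=; field; rewrite gt_eqF.
by rewrite {4}E/=; field; rewrite gt_eqF.
Qed.

Lemma energy_density_plane J p q : wash_current J -> annulus p -> annulus q ->
  energy_density J (plane p) (plane q) =
  lambda (rad p) / rad p * (lambda (rad q) / rad q) *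
    (p.1 * q.1 + p.2 * q.2) / rad (p - q).
Proof.
move=> HJ ap aq; rewrite /energy_density.
rewrite (current_plane J p HJ ap) (current_plane J q HJ aq).
rewrite dot_plane /=.
rewrite planeB enorm_plane.
by congr (_ / _); ring.
Qed.

Lemma energy_density_bound J p q : wash_current J -> annulus p -> annulus q ->
  (`|(energy_density J (plane p) (plane q))%:E| <=
   (81 * 81)%:E * (16%:E * (16%:E * majorant (p, q))))%E.
Proof.
move=> HJ ap aq; rewrite energy_density_plane//.
have p0 : 0 < rad p by case/andP: ap => + _; apply: lt_le_trans.
have q0 : 0 < rad q by case/andP: aq => + _; apply: lt_le_trans.
have /andP[lp0 _] := lambda_le _ ap; have /andP[lq0 _] := lambda_le _ aq.
(* At p = q the density is 0, because the inverse of 0 is 0. *)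
have [d0|d0] := eqVneq (rad (p - q)) 0.
  by rewrite d0 invr0 mulr0 abse0 !mule_ge0// ?lee_fin// majorant_ge0.
have {}d0 : 0 < rad (p - q) by rewrite lt_neqAle eq_sym d0 rad_ge0.
apply: le_trans (lambda_kernel_bound p q ap aq d0).
rewrite lee_fin normrM normfV (gtr0_norm d0); apply: ler_wpM2r.
  by rewrite invr_ge0 ltW.
have CS := cauchy_schwarz p q.
move: lp0 lq0; move: (lambda (rad p)) (lambda (rad q)) => x y x0 y0.
have xy0 : 0 <= x / rad p * (y / rad q) by rewrite mulr_ge0// divr_ge0// ltW.
rewrite normrM (ger0_norm xy0); apply: (le_trans (ler_wpM2l xy0 CS)).
rewrite le_eqVlt; apply/orP; left; apply/eqP; field.
by rewrite !gt_eqF.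
Qed.

Lemma measurable_lambda : measurable_fun setT (@lambda R).
Proof.
apply: measurable_fun_inv; apply: measurable_funM.
  by apply: measurable_funB.
apply: measurable_funX; apply: (measurableT_comp (@measurable_ln R)).
by apply: measurable_fun_inv; apply: measurable_funB.
Qed.

Let m11 : measurable_fun setT (fun z : (R * R) * (R * R) => z.1.1).
Proof. exact: measurableT_comp measurable_fst measurable_fst. Qed.
Let m12 : measurable_fun setT (fun z : (R * R) * (R * R) => z.1.2).
Proof. exact: measurableT_comp measurable_snd measurable_fst. Qed.
Let m21 : measurable_fun setT (fun z : (R * R) * (R * R) => z.2.1).
Proof. exact: measurableT_comp measurable_fst measurable_snd. Qed.
Let m22 : measurable_fun setT (fun z : (R * R) * (R * R) => z.2.2).
Proof. exact: measurableT_comp measurable_snd measurable_snd. Qed.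

Lemma measurable_density_weight d (T : measurableType d) (f : T -> R * R) :
  measurable_fun setT (fst \o f) -> measurable_fun setT (snd \o f) ->
  measurable_fun setT (fun z => lambda (rad (f z)) / rad (f z)).
Proof.
move=> m1 m2; have mr := measurable_rad _ _ f m1 m2.
apply: measurable_funM; last exact: measurable_fun_inv.
exact: (measurableT_comp measurable_lambda mr).
Qed.

Lemma measurable_energy_density J : wash_current J ->
  measurable_fun (annulus `*` annulus)
    (fun z : (R * R) * (R * R) => (energy_density J (plane z.1) (plane z.2))%:E).
Proof.
move=> HJ; apply/measurable_EFinP.
apply: (@eq_measurable_fun _ _ _ _ _ (fun z => lambda (rad z.1) / rad z.1 * (lambda (rad z.2) / rad z.2) *
    (z.1.1 * z.2.1 + z.1.2 * z.2.2) / rad (z.1 - z.2))).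
  by move=> z; rewrite inE => -[a1 a2]; rewrite energy_density_plane.
apply: measurable_funTS; apply: measurable_funM.
  apply: measurable_funM.
    by apply: measurable_funM; apply: measurable_density_weight.
  by apply: measurable_funD; apply: measurable_funM.
apply: measurable_fun_inv.
apply: (@measurable_rad _ _ _ (fun z : (R * R) * (R * R) => z.1 - z.2)).
  exact: (measurable_funB m11 m21).
exact: (measurable_funB m12 m22).
Qed.

Local Notation TR := (measurableTypeR R).

Lemma measurable_annulus2 : measurable (annulus `*` annulus : set ((TR * TR) * (TR * TR))).
Proof. by apply: measurableX; exact: measurable_annulus. Qed.

Local Notation nu := (@plane_measure R).

Lemma integrable_energy_density J : wash_current J ->
  (nu \x nu)%E.-integrable (annulus `*` annulus)
    (fun z => (energy_density J (plane z.1) (plane z.2))%:E).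
Proof.
move=> HJ.
have iM : (nu \x nu)%E.-integrable setT (@majorant R).
  apply/integrableP; split; first exact: measurable_majorant.
  under eq_integral => z _ do rewrite gee0_abs ?majorant_ge0//.
  exact: integral_majorant.
have mA := measurable_annulus2.
have {}iM := integrableS measurableT mA (@subsetT _ _) iM.
have i1 := integrableZl mA 16 iM; have i2 := integrableZl mA 16 i1.
have i3 := integrableZl mA (81 * 81) i2.
apply: (le_integrable mA (measurable_energy_density J HJ) _ i3) => z [a1 a2].
rewrite [leRHS]gee0_abs; last by rewrite !mule_ge0// ?lee_fin// majorant_ge0.
by rewrite {3}(surjective_pairing z); exact: energy_density_bound.
Qed.

(** Absolute integrability lets Fubini's theorem identify the iterated integral with the double
    integral of the extension by 0, which is finite. *)
Lemma energy_fin (J : 'rV[R]_3 -> 'rV[R]_3) : wash_current J -> (energy J < +oo)%E.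
Proof.
move=> HJ; have iE := integrable_energy_density J HJ.
have mA := measurable_annulus2.
pose f (z : (R * R) * (R * R)) := (energy_density J (plane z.1) (plane z.2))%:E.
have iF : (nu \x nu)%E.-integrable setT (f \_ (annulus `*` annulus)).
  by apply/(integrable_mkcond _ mA).
have FE := integral12_prod_meas1 iF.
have := integrable_fin_num measurableT iF; rewrite -FE fin_numElt => /andP[_].
suff -> : energy J = (\int[nu]_p fubini_F nu (f \_ (annulus `*` annulus)) p)%E by [].
rewrite /energy /area_integral preimage_wash integral_mkcond /fubini_F /plane_measure.
apply: eq_integral => p _; rewrite patchE.
case: ifPn => [|/negP] pA; last first.
  rewrite integral0_eq// => q _; rewrite patchE memNset// => -[/= pA' _].
  by apply: pA; rewrite inE.
rewrite inE in pA; rewrite [LHS]integral_mkcond; apply: eq_integral => q _.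
rewrite !patchE; case: ifPn => [|/negP] qA.
  by rewrite mem_set//; split => //=; rewrite inE in qA.
by rewrite memNset// => -[/= _ qA']; apply: qA; rewrite inE.
Qed.

Lemma finite_energy_wash (J : 'rV[R]_3 -> 'rV[R]_3) : wash_current J -> finite_energy J.
Proof.
move=> HJ; split; last exact: energy_fin.
rewrite preimage_wash; exact: integrable_energy_density.
Qed.

End Energy.

(** * The unit circle *)

Section RealIntegrals.
Context {R : realType}.
Local Notation mu := (@lebesgue_measure R).

Lemma is_derive_inv_ln (x : R) : 0 < x < 1 ->
  is_derive x 1 (fun y => (ln y)^-1) (- (x * ln x ^+ 2)^-1).
Proof.
move=> xr; have l0 := ln_lt0 xr; have /andP[x0 x1] := xr.
have D1 := is_derive1_ln x0.
have dl : derivable (@ln R) x 1 by exact: ex_derive.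
apply: DeriveDef; first by apply: derivableV => //; rewrite lt_eqF.
by rewrite deriveV ?lt_eqF// derive_val /GRing.scale/= mulNr (invfM x) (mulrC x^-1).
Qed.

(** The primitive is 1 / ln(h - y). The depth a^2 has twice the logarithm of the depth a, so half of
    the total mass 1 / log(1/a) of depths below a remains. *)
Lemma integral_inv_ln (h a : R) : 0 < a <= 1 / 4 ->
  (\int[mu]_(y in `[(h - a)%R, (h - a ^+ 2)%R]) (((h - y) * ln (h - y) ^+ 2)^-1)%:E
   = (- (2 * ln a)^-1)%:E)%E.
Proof.
move=> /andP[a0 a1]; have aa : a ^+ 2 < a by rewrite expr2; nra.
have a20 : 0 < a ^+ 2 by rewrite exprn_gt0.
have rng y : h - a <= y <= h - a ^+ 2 -> 0 < h - y < 1 by move=> /andP[? ?]; lra.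
have dh (y : R) : is_derive y 1 (fun y => h - y) (-1).
  by rewrite -[-1]add0r; apply: is_deriveB.
have D y : h - a <= y <= h - a ^+ 2 ->
    is_derive y 1 (fun y => (ln (h - y))^-1) ((h - y) * ln (h - y) ^+ 2)^-1.
  move=> /rng yr.
  have := @is_derive1_comp R (fun y => (ln y)^-1) (fun y => h - y) y _ _ (is_derive_inv_ln _ yr) (dh y).
  by rewrite mulrN1 opprK.
rewrite (@integral_derivative R (fun y => ((h - y) * ln (h - y) ^+ 2)^-1) (fun y => (ln (h - y))^-1))//.
- have la : ln a < 0 by apply: ln_lt0; lra.
  congr EFin; have -> : h - (h - a ^+ 2) = a ^+ 2 by ring.
  have -> : h - (h - a) = a by ring.
  by rewrite lnXn// mulr2n; field; rewrite !lt_eqF//; lra.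
- by rewrite ltrD2l ltrN2.
- move=> y /rng yr; have /andP[y0 y1] := yr; have l0 := ln_lt0 yr.
  apply: cvgV; first by rewrite mulf_eq0 negb_or gt_eqF//= expf_neq0// lt_eqF.
  have ch : {for y, continuous (fun y => h - y)}.
    by apply: cvgB; [exact: cvg_cst|exact: cvg_id].
  apply: cvgM; first exact: ch.
  apply: (@continuous_comp _ _ _ (fun y => ln (h - y)) (fun y => y ^+ 2)); last exact: exprn_continuous.
  by apply: (@continuous_comp _ _ _ (fun y => h - y) (@ln R)); [exact: ch|exact: continuous_ln].
Qed.

(** The primitive - ln(- ln(v - c)) is a double logarithm, so the integral is unbounded as e tends
    to 0. *)
Lemma integral_inv_xln (c e t : R) : 0 < e < t -> t <= 1 / 4 ->
  (\int[mu]_(v in `[(c + e)%R, (c + t)%R]) (- ((v - c) * ln (v - c))^-1)%:E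
   = (ln (- ln e) - ln (- ln t))%:E)%E.
Proof.
move=> /andP[e0 et] t1.
have rng v : c + e <= v <= c + t -> 0 < v - c < 1 by move=> /andP[? ?]; lra.
have dh (y : R) : is_derive y 1 (fun y => y - c) 1.
  by rewrite -[1 in X in is_derive _ _ _ X]subr0; apply: is_deriveB.
have -> : ln (- ln e) - ln (- ln t) =
    - ln (- ln (c + t - c)) - - ln (- ln (c + e - c)).
  have -> : c + t - c = t by ring.
  have -> : c + e - c = e by ring.
  by ring.
apply: (@integral_derivative R _ (fun v => - ln (- ln (v - c)))).
- by rewrite ltrD2l.
- move=> v /rng vr; have /andP[v0 v1] := vr; have l0 := ln_lt0 vr.
  have D1 := @is_derive1_comp R (@ln R) (fun y => y - c) v _ _ (is_derive1_ln v0) (dh v).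
  have D2 := @is_deriveN _ _ _ _ _ _ _ D1.
  have nl : 0 < - ln (v - c) by lra.
  have D3 := @is_derive1_comp R (@ln R) (fun y => - ln (y - c)) v _ _ (is_derive1_ln nl) D2.
  have := @is_deriveN _ _ _ _ _ _ _ D3.
  by have -> // : - ((- ln (v - c))^-1 * - ((v - c)^-1 * 1)) = - ((v - c) * ln (v - c))^-1;
    rewrite mulr1 invrN mulrNN invfM mulrC.
- move=> y /rng yr; have /andP[y0 y1] := yr; have l0 := ln_lt0 yr.
  have ch : {for y, continuous (fun y => y - c)}.
    by apply: cvgB; [exact: cvg_id|exact: cvg_cst].
  apply: cvgN; apply: cvgV; first by rewrite mulf_eq0 negb_or gt_eqF//= lt_eqF.
  apply: cvgM; first exact: ch.
  by apply: (@continuous_comp _ _ _ (fun y => y - c) (@ln R)); [exact: ch|exact: continuous_ln].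
Qed.

End RealIntegrals.

(** * The unit circle as a smooth closed curve *)

Section Circle.
Context {R : realType}.

Definition circle (u : R) : 'rV[R]_3 := plane (cos u, sin u).

Lemma is_derive_sinD (a u : R) : is_derive u 1 (fun x => sin (x + a)) (cos (u + a)).
Proof.
have D : is_derive u 1 (fun x : R => x + a) 1.
  by rewrite -[1 in X in is_derive _ _ _ X]addr0; apply: is_deriveD.
by have := @is_derive1_comp R (@sin R) (fun x => x + a) u _ _ (is_derive_sin (u + a)) D; rewrite mulr1.
Qed.

Lemma is_derive_cosD (a u : R) : is_derive u 1 (fun x => cos (x + a)) (- sin (u + a)).
Proof.
have D : is_derive u 1 (fun x : R => x + a) 1.
  by rewrite -[1 in X in is_derive _ _ _ X]addr0; apply: is_deriveD.
by have := @is_derive1_comp R (@cos R) (fun x => x + a) u _ _ (is_derive_cos (u + a)) D; rewrite mulr1.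
Qed.

Lemma is_derive_plane (f g : R -> R) (u df dg : R) :
  is_derive u 1 f df -> is_derive u 1 g dg ->
  is_derive u 1 (fun x => plane (f x, g x)) (plane (df, dg)).
Proof.
move=> Df Dg.
have D i j : is_derive u 1 (fun x => plane (f x, g x) i j) (plane (df, dg) i j).
  rewrite (_ : (fun x => _) = (fun x => [:: f x; g x; 0]`_j)); last first.
    by apply/funext => x; rewrite mxE.
  by rewrite mxE; case: j => -[|[|[|//]]] j3 /=; [exact: Df|exact: Dg|exact: is_derive_cst].
have dv : derivable (fun x => plane (f x, g x)) u 1.
  by apply/derivable_mxP => i j; have := D i j => Dij; exact: ex_derive.
apply: DeriveDef => //; rewrite derive_mx//; apply/matrixP => i j; rewrite mxE.
exact: (@derive_val _ _ _ _ _ _ _ (D i j)).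
Qed.

(** Each differentiation advances the phase by a quarter turn; the closed form reduces smoothness to
    one derivative of a shifted circle. *)
Lemma derive1n_circle n :
  derive1n n circle = fun u => plane (cos (u + pi / 2 *+ n), sin (u + pi / 2 *+ n)).
Proof.
elim: n => [|n IH]; first by apply/funext => u; rewrite derive1n0 mulr0n addr0.
rewrite derive1nS IH; apply/funext => u; rewrite derive1E.
have D := is_derive_plane _ _ u _ _ (is_derive_cosD (pi / 2 *+ n) u) (is_derive_sinD (pi / 2 *+ n) u).
by rewrite derive_val (mulrSr (pi / 2)) addrA cosDpihalf sinDpihalf.
Qed.

Lemma smooth_circle : smooth circle.
Proof.
move=> n u; rewrite derive1n_circle.
have D := is_derive_plane _ _ u _ _ (is_derive_cosD (pi / 2 *+ n) u) (is_derive_sinD (pi / 2 *+ n) u).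
exact: ex_derive.
Qed.

Lemma derive1_circle u : derive1 circle u = plane (- sin u, cos u).
Proof.
by have := derive1n_circle 1; rewrite derive1n1 => ->; rewrite mulr1n cosDpihalf sinDpihalf.
Qed.

Lemma speed_circle u : speed circle u = 1.
Proof.
rewrite /speed derive1_circle enorm_plane /rad/=.
by rewrite sqrrN addrC cos2Dsin2 sqrtr1.
Qed.

Lemma unit_tangent_circle u : unit_tangent circle u = plane (- sin u, cos u).
Proof. by rewrite /unit_tangent speed_circle invr1 scale1r derive1_circle. Qed.

Lemma piecewise_smooth_circle : piecewise_smooth (- pi) pi circle.
Proof.
exists 0%N, (fun i => if i is 0%N then - pi else pi); split => // i.
rewrite leqn0 => /eqP ->; split; first by have := pi_gt0 R; lra.
exists circle; split; first exact: smooth_circle.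
move=> u _; split=> //; apply/eqP => d0.
have := speed_circle u; rewrite /speed d0 /enorm /dot big1 ?sqrtr0.
  by move=> /eqP; rewrite eq_sym oner_eq0.
by move=> i0 _; rewrite mxE mul0r.
Qed.

Lemma closed_circle : closed_curve (- pi) pi circle.
Proof. by rewrite /closed_curve /circle cosN sinN sinpi oppr0. Qed.

Lemma length_circle : (curve_length (- pi) pi circle < +oo)%E.
Proof.
rewrite /curve_length; under eq_integral do rewrite speed_circle.
rewrite integral_cst//= lebesgue_measure_itv/= mul1e.
by case: ifP; rewrite ?ltry.
Qed.

End Circle.

(** * Flux *)

(** Density, up to the factor 1 / (4 pi), of the component of the potential along the unit tangent
    of the circle at angle u. Current and tangent are radial directions turned by a right angle, so
    their scalar product is that of the radial directions. *)
Definition axial {R : realType} (u : R) (p : R * R) : R :=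
  lambda (rad p) / rad p * (p.1 * cos u + p.2 * sin u) / rad ((cos u, sin u) - p).

(** * Pointwise bounds for the axial density *)

Section Axial.
Context {R : realType}.
Implicit Types (u : R) (p : R * R).

Lemma rad_circle u : rad (cos u, sin u) = 1.
Proof. by rewrite /rad /= cos2Dsin2 sqrtr1. Qed.

(* A negative sign forces x and p into opposite half planes, hence at distance >= 1. *)
Lemma axial_ge p u : annulus p -> - axial u p <= lambda (rad p).
Proof.
move=> ap; have /andP[l0 _] := lambda_le _ ap.
have r0 : 0 < rad p by case/andP: ap => + _; apply: lt_le_trans.
rewrite /axial; set w := _ + _; set d := rad (_ - p).
have d0 : 0 <= d := rad_ge0 _.
have k0 : 0 <= lambda (rad p) / rad p by rewrite divr_ge0// ltW.
have [w0|w0] := leP 0 w.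
  by apply: le_trans l0; rewrite oppr_le0 mulr_ge0 ?invr_ge0// mulr_ge0.
have wr : - w <= rad p.
  have := le_trans (ler_norm _) (eq_ind_r (fun x => x <= _) (cauchy_schwarz p (cos u, sin u)) (normrN _)).
  by rewrite rad_circle mulr1.
(* Law of cosines: d^2 = 1 + r^2 - 2w, with w negative here. *)
have d1 : 1 <= d.
  rewrite -(@ler_pXn2r _ 2) ?nnegrE// expr1n rad_sqr /=.
  rewrite (_ : _ + _ = (cos u ^+ 2 + sin u ^+ 2) + (p.1 ^+ 2 + p.2 ^+ 2) - 2 * w); last by rewrite /w; ring.
  by rewrite cos2Dsin2 -rad_sqr; have := sqr_ge0 (rad p); clear -w0; lra.
rewrite -mulNr -mulrN ler_pdivrMr ?(lt_le_trans _ d1)//.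
apply: (@le_trans _ _ (lambda (rad p))); last by rewrite ler_peMr.
rewrite -mulrA -[leRHS]mulr1; apply: ler_wpM2l => //.
by rewrite mulrC ler_pdivrMr// mul1r.
Qed.

(** Since [ell] is at least 1, its sixth power in [lambda_le] may be lowered to the fourth power in
    [dens]. *)
Lemma lambda_shells p : annulus p ->
  ((lambda (rad p))%:E <= (81 * 4)%:E * shells p)%E.
Proof.
move=> ap; have /andP[_ l1] := lambda_le _ ap; have /andP[r1 r2] := ap.
rewrite (EFinM 81) -muleA; apply: le_trans (lee_wpmul2l _ (shells_dens p ap)); last by rewrite lee_fin.
rewrite -EFinM lee_fin; apply: (le_trans l1); apply: ler_wpM2l => //.
have sr : 0 < 1 - rad p <= 2 by clear -r1 r2; lra.
have e1 : 1 <= ell (1 - rad p).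
  rewrite -(@ler_pXn2r _ 3) ?nnegrE ?(ltW (ell_gt0 _ sr))// expr1n ell_cube//.
  by have := ln_sub_ge3 _ sr; clear; lra.
have s0 : 0 < 1 - rad p by case/andP: sr.
rewrite densE; move: (ell _) e1 => e e1; have e0 : 0 < e by exact: lt_le_trans e1.
rewrite lef_pV2 ?posrE ?mulr_gt0 ?exprn_gt0//; apply: ler_wpM2l; first exact: ltW.
by apply: ler_weXn2l.
Qed.

(** For t <= 1/4, ln(1 - r) >= ln t - ln 2 >= 2 ln t, so the squared logarithm at the depth 1 - r is
    at most four times that at t. *)
Lemma lambda_ge (r t : R) : 0 < 1 - r -> 1 - r <= t -> t / 2 <= 1 - r -> t <= 1 / 4 ->
  (4 * (t * ln t ^+ 2))^-1 <= lambda r.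
Proof.
move=> s0 st ts t4; have t0 : 0 < t by exact: lt_le_trans st.
have th : 0 < t / 2 by rewrite divr_gt0.
have ltn : ln t < 0 by apply: ln_lt0; rewrite t0; clear -t4; lra.
have lsn : ln (1 - r) < 0 by apply: ln_lt0; rewrite s0; clear -st t4; lra.
have lsth : ln (t / 2) <= ln (1 - r) by rewrite ler_ln ?posrE.
have l2t : ln t <= - ln 2.
  rewrite -lnV ?posrE// ler_ln ?posrE ?invr_gt0//.
  by clear -t4; lra.
have lt2 : ln (t / 2) = ln t - ln 2 by rewrite ln_div ?posrE.
have l2 : 2 * ln t <= ln (1 - r) by clear -lsth l2t lt2; lra.
rewrite /lambda lnV ?posrE// sqrrN.
have sq : ln (1 - r) ^+ 2 <= 4 * ln t ^+ 2.
  by clear -l2 lsn ltn; nra.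
have sq0 : 0 < ln (1 - r) ^+ 2 by rewrite exprn_even_gt0//= lt_eqF.
have tq0 : 0 < ln t ^+ 2 by rewrite exprn_even_gt0//= lt_eqF.
have P1 : 0 < 4 * (t * ln t ^+ 2) by rewrite mulr_gt0// mulr_gt0.
have P2 : 0 < (1 - r) * ln (1 - r) ^+ 2 by rewrite mulr_gt0.
rewrite lef_pV2 ?posrE// (mulrCA 4); apply: ler_pM => //; exact: ltW.
Qed.

(* a is the vertical offset from the point of the unit circle at the angle u, and t <= a the
   horizontal gap between (y, v) and the circle, so that the distance is O(a) and the depth
   is comparable to t. *)
Lemma axial_lower u (a y v t : R) : 1 / 2 <= cos u -> `|sin u| <= 1 / 4 ->
  0 < a <= 1 / 4 -> v = sin u + a -> t = Num.sqrt (1 - v ^+ 2) - y ->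
  a ^+ 2 <= t <= a ->
  annulus (y, v) /\ (96 * a)^-1 * (t * ln t ^+ 2)^-1 <= axial u (y, v).
Proof.
have cd := cos2Dsin2 u; rewrite /axial.
move: (cos u) (sin u) cd => c d cd c1; rewrite ler_norml => /andP[d1 d2] /andP[a0 a1] vE.
set h := Num.sqrt _ => tE /andP[ta1 ta].
have t0 : 0 < t by apply: lt_le_trans ta1; rewrite exprn_gt0.
have t4 : t <= 1 / 4 by exact: le_trans a1.
have v2 : v ^+ 2 <= 1 / 4 by rewrite vE; clear -d1 d2 a0 a1; nra.
have h0 : 0 <= h := sqrtr_ge0 _.
have hE : h ^+ 2 = 1 - v ^+ 2 by rewrite sqr_sqrtr//; clear -v2; lra.
have h34 : 3 / 4 <= h by clear -hE v2 h0; nra.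
have h1 : h <= 1 by have := sqr_ge0 v; clear -hE h0; nra.
have yE : y = h - t by rewrite tE; ring.
have y1 : 1 / 2 <= y by rewrite yE; clear -h34 t4; lra.
have rE := rad_sqr (y, v); have r0 := rad_ge0 (y, v); have ry := normr1_rad (y, v).
rewrite /= in rE ry; rewrite (ger0_norm (le_trans _ y1)) in ry; last by clear; lra.
(* Difference of squares. As 5/4 <= h + y <= 1 + r < 2 for r the radius, the depth 1 - r lies
   between t/2 and t. *)
have rt : (1 - rad (y, v)) * (1 + rad (y, v)) = t * (h + y).
  transitivity (1 - rad (y, v) ^+ 2); first by ring.
  by rewrite rE yE; clear -hE; rewrite (_ : v ^+ 2 = 1 - h ^+ 2); [ring|lra].
have r1 : rad (y, v) < 1.
  have : 0 < t * (h + y) by rewrite mulr_gt0//; clear -h34 y1; lra.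
  by rewrite -rt; clear -r0; nra.
have st : 1 - rad (y, v) <= t by clear -rt ry h1 r0 t0; nra.
have ts : t / 2 <= 1 - rad (y, v) by clear -rt h34 y1 r1 r0 t0; nra.
split; first by rewrite /annulus /= r1 (le_trans y1).
have s0 : 0 < 1 - rad (y, v) by rewrite subr_gt0.
have L := lambda_ge _ _ s0 st ts t4.
have ltn : ln t < 0 by apply: ln_lt0; rewrite t0; clear -t4; lra.
have Q0 : 0 < t * ln t ^+ 2 by rewrite mulr_gt0// exprn_even_gt0//= lt_eqF.
have w8 : 1 / 8 <= y * c + v * d.
  by rewrite vE; clear -y1 c1 d1 d2 a0 a1; nra.
(* The points (c, d) and (h, v) lie on the circle, so c^2 - h^2 = v^2 - d^2 = a(2d + a), while c + h
   >= 5/4. *)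
have ch : `|c - h| <= a.
  have E : (c - h) * (c + h) = a * (2 * d + a).
    transitivity (c ^+ 2 - h ^+ 2); first by ring.
    by rewrite hE vE; clear -cd; rewrite (_ : c ^+ 2 = 1 - d ^+ 2); [ring|lra].
  rewrite ler_norml; clear -E c1 h34 d1 d2 a0 a1.
  by apply/andP; split; nra.
have cy : `|c - y| <= 2 * a.
  rewrite (_ : c - y = (c - h) + t); last by rewrite yE; ring.
  by rewrite (le_trans (ler_normD _ _))// (gtr0_norm t0); clear -ch ta; lra.
have dv : rad ((c, d) - (y, v)) <= 3 * a.
  rewrite -(@ler_pXn2r _ 2) ?nnegrE ?rad_ge0 ?mulr_ge0 ?(ltW a0)//.
  rewrite rad_sqr /= -(real_normK (num_real (c - y))).
  rewrite (_ : d - v = - a); last by rewrite vE; ring.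
  by rewrite sqrrN; have := normr_ge0 (c - y); clear -cy a0; nra.
have dv0 : 0 < rad ((c, d) - (y, v)).
  apply: lt_le_trans (normr2_rad _).
  by rewrite /= vE opprD addrA subrr add0r normrN gtr0_norm.
have r00 : 0 < rad (y, v) by clear -ry y1; lra.
rewrite /=; move: L dv dv0 r00 r1 w8; move: (lambda (rad (y, v))) => l.
move: (rad ((c, d) - (y, v))) (rad (y, v)) (y * c + v * d) => D r w L dv dv0 r00 r1 w8.
have l0 : 0 < l by apply: lt_le_trans L; rewrite invr_gt0 mulr_gt0.
(* The constant is 96 = 4 * 8 * 3: 4 from [lambda_ge], 1/8 from the scalar product and 3 from the
   distance. *)
apply: (@le_trans _ _ ((4 * (t * ln t ^+ 2))^-1 * (1 / 8) / (3 * a))).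
  rewrite le_eqVlt; apply/orP; left; apply/eqP.
  move: (t * ln t ^+ 2) Q0 => q q0; field.
  by rewrite !gt_eqF.
apply: ler_pM.
- by rewrite mulr_ge0// invr_ge0 ltW// mulr_gt0.
- by rewrite invr_ge0 mulr_ge0// ltW.
- apply: ler_pM => //; first by rewrite invr_ge0 ltW// mulr_gt0.
  apply: (le_trans L); rewrite ler_pdivlMr//.
  by rewrite ler_piMr ?ltW.
- by rewrite lef_pV2 ?posrE ?mulr_gt0.
Qed.

Lemma potential_density_circle J u p : wash_current J -> annulus p ->
  potential_density J (circle u) (unit_tangent circle u) (plane p) = axial u p.
Proof.
move=> HJ ap; rewrite /potential_density unit_tangent_circle.
rewrite (current_plane J p HJ ap) dot_plane /circle planeB enorm_plane /=.
by rewrite /axial; congr (_ / _); ring.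
Qed.

Lemma measurable_axial :
  measurable_fun setT (fun z : R * (R * R) => axial z.1 z.2).
Proof.
have m1 : measurable_fun setT (fun z : R * (R * R) => z.2.1).
  exact: measurableT_comp measurable_fst measurable_snd.
have m2 : measurable_fun setT (fun z : R * (R * R) => z.2.2).
  exact: measurableT_comp measurable_snd measurable_snd.
have mc : measurable_fun setT (fun z : R * (R * R) => cos z.1).
  by apply: (measurableT_comp (continuous_measurable_fun (@continuous_cos R))).
have ms : measurable_fun setT (fun z : R * (R * R) => sin z.1).
  by apply: (measurableT_comp (continuous_measurable_fun (@continuous_sin R))).
apply: measurable_funM.
  apply: measurable_funM; first exact: measurable_density_weight.
  by apply: measurable_funD; apply: measurable_funM.
apply: measurable_fun_inv.
apply: (@measurable_rad _ _ _ (fun z : R * (R * R) => (cos z.1, sin z.1) - z.2)).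
  exact: (measurable_funB mc m1).
exact: (measurable_funB ms m2).
Qed.

End Axial.

(** * Divergence of the potential on an arc, and the flux through the circle *)

Section Flux.
Context {R : realType}.
Local Notation mu := (@lebesgue_measure R).
Local Notation nu := (@plane_measure R).
Local Notation TR := (measurableTypeR R).
Local Open Scope ereal_scope.
Implicit Types u : R.

(** Extension by 0 off the washer gives a jointly measurable function on the whole product, as
    Tonelli's theorem requires. *)
Definition axial_on_annulus (z : TR * (TR * TR)) : \bar R :=
  if z.2 \in annulus then (axial z.1 z.2)%:E else 0.

Lemma measurable_axial_on_annulus : measurable_fun setT axial_on_annulus.
Proof.
apply: measurable_fun_ifT => //.
  have mA : measurable [set z : TR * (TR * TR) | z.2 \in annulus].
    rewrite (_ : [set z | _] = setT `&` (snd : TR * (TR * TR) -> TR * TR) @^-1` annulus).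
      by apply: measurable_snd => //; exact: measurable_annulus.
    by apply/seteqP; split => z /=; rewrite inE ?setTI //; case.
  apply: (@measurable_fun_bool _ _ _ _ true).
  by rewrite setTI.
by apply/measurable_EFinP; exact: measurable_axial.
Qed.

Lemma measurable_axial_pos : measurable_fun setT axial_on_annulus^\+.
Proof. exact: measurable_funepos measurable_axial_on_annulus. Qed.

Lemma measurable_axial_neg : measurable_fun setT axial_on_annulus^\-.
Proof. exact: measurable_funeneg measurable_axial_on_annulus. Qed.

Definition axial_int_pos u := \int[nu]_p axial_on_annulus^\+ (u, p).

Definition axial_int_neg u := \int[nu]_p axial_on_annulus^\- (u, p).

Lemma axial_neg_le (z : TR * (TR * TR)) :
  axial_on_annulus^\- z <= (81 * 4)%:E * shells z.2.
Proof.
have S0 : 0 <= (81 * 4)%:E * shells z.2 by rewrite mule_ge0 ?shells_ge0// lee_fin.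
rewrite funenegE /axial_on_annulus; case: ifPn => [|_]; last by rewrite oppe0 maxxx.
rewrite inE => ap; rewrite ge_max S0 andbT.
by apply: le_trans (lambda_shells z.2 ap); rewrite -EFinN lee_fin; exact: axial_ge.
Qed.

Lemma axial_int_neg_le u : axial_int_neg u <= (81 * 4 * 48)%:E.
Proof.
apply: (@le_trans _ _ (\int[nu]_p ((81 * 4)%:E * shells p))).
  apply: ge0_le_integral => //.
  - exact: (measurableT_comp measurable_axial_neg (measurable_pair1 u)).
  - by apply: measurable_funeM; exact: measurable_shells.
  - by move=> p _; exact: axial_neg_le (u, p).
rewrite ge0_integralZl//; [|exact: measurable_shells|by move=> p _; exact: shells_ge0].
by rewrite (EFinM (81 * 4)); apply: lee_wpmul2l; [rewrite lee_fin|exact: integral_shells].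
Qed.

(** On the horizontal line at height sin u + a only gaps t in [a^2, a] are kept. There [axial_lower]
    applies and the integral over t is -1 / (2 ln a), hence 192 = 96 * 2. *)
Lemma axial_section_ge u (a : R) : (1 / 2 <= cos u)%R -> (`|sin u| <= 1 / 4)%R ->
  (0 < a <= 1 / 4)%R ->
  (192^-1 * - (a * ln a)^-1)%:E <= \int[mu]_y axial_on_annulus^\+ (u, (y, (sin u + a)%R)).
Proof.
move=> cu su ar; have /andP[a0 a4] := ar.
pose h := Num.sqrt (1 - (sin u + a) ^+ 2).
pose I : set TR := `[(h - a)%R, (h - a ^+ 2)%R]%classic.
have mI : measurable I by exact: measurable_itv.
pose f (y : TR) := axial_on_annulus^\+ (u, (y, (sin u + a)%R)).
have mf : measurable_fun setT f.
  have mu1 := measurableT_comp measurable_axial_pos (measurable_pair1 u).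
  exact: (measurableT_comp mu1 (measurable_pair2 (sin u + a)%R)).
have f0 y : 0 <= f y by exact: funepos_ge0.
apply: (@le_trans _ _ (\int[mu]_(y in I) f y)); last exact: ge0_subset_integral.
have -> : (192^-1 * - (a * ln a)^-1)%:E = ((96 * a)^-1)%:E * (- (2 * ln a)^-1)%:E.
  rewrite -EFinM; congr EFin; have la : (ln a < 0)%R by apply: ln_lt0; rewrite a0; clear -a4; lra.
  by field; rewrite lt_eqF// gt_eqF.
rewrite -(integral_inv_ln h a ar).
have mg : measurable_fun setT (fun y : TR => (((h - y) * ln (h - y) ^+ 2)^-1)%:E).
  have mh : measurable_fun setT (fun y : R => h - y)%R by exact: measurable_funB.
  apply/measurable_EFinP; apply: measurable_fun_inv; apply: measurable_funM => //.
  by apply: measurable_funX; exact: (measurableT_comp (@measurable_ln R) mh).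
have g0 (y : TR) : I y -> 0 <= (((h - y) * ln (h - y) ^+ 2)^-1)%:E.
  rewrite /I/= in_itv/= => /andP[_ ya]; rewrite lee_fin invr_ge0 mulr_ge0 ?sqr_ge0//.
  by rewrite subr_ge0 (le_trans ya)// gerBl sqr_ge0.
have k0 : 0 <= ((96 * a)^-1)%:E by rewrite lee_fin invr_ge0 mulr_ge0// ltW.
rewrite -ge0_integralZl//; last exact: measurable_funTS.
apply: ge0_le_integral => //.
- by move=> y Iy; rewrite mule_ge0// g0.
- by apply: measurable_funTS; exact: measurable_funeM.
- exact: measurable_funTS.
move=> y; rewrite /I/= in_itv/= => /andP[y1 y2].
have [] := @axial_lower R u a y (sin u + a)%R (h - y)%R cu su ar erefl erefl.
  by apply/andP; split; [move: y2|move: y1]; clear; lra.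
move=> yA L; rewrite /f funeposE le_max; apply/orP; left.
by rewrite /axial_on_annulus /= mem_set// -EFinM lee_fin.
Qed.

(** Tonelli with the height outermost: the section bounds of order 1 / (a log(1/a)) are integrated
    over the offsets a from e to 1/4. *)
Lemma axial_int_pos_ge u (e : R) : (1 / 2 <= cos u)%R -> (`|sin u| <= 1 / 4)%R ->
  (0 < e < 1 / 4)%R ->
  (192^-1 * (ln (- ln e) - ln (- ln (1 / 4))))%:E <= axial_int_pos u.
Proof.
move=> cu su er; have /andP[e0 e1] := er.
pose f (p : TR * TR) := axial_on_annulus^\+ (u, p).
have mf : measurable_fun setT f.
  exact: (measurableT_comp measurable_axial_pos (measurable_pair1 u)).
have f0 p : 0 <= f p by exact: funepos_ge0.
pose G v := \int[mu]_y f (y, v).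
have mG : measurable_fun setT G by exact: (@measurable_fun_fubini_tonelli_G _ _ TR TR R mu f mf f0).
have G0 v : 0 <= G v by exact: integral_ge0.
rewrite (_ : axial_int_pos u = \int[mu]_v G v); last first.
  by rewrite /axial_int_pos /plane_measure (@fubini_tonelli2 _ _ TR TR R mu mu f mf f0).
pose I : set TR := `[(sin u + e)%R, (sin u + 1 / 4)%R]%classic.
have mI : measurable I by exact: measurable_itv.
apply: (@le_trans _ _ (\int[mu]_(v in I) G v)); last exact: ge0_subset_integral.
rewrite EFinM -(integral_inv_xln (sin u) e (1 / 4) er (lexx _)).
have mh : measurable_fun setT (fun v : R => v - sin u)%R by exact: measurable_funB.
have mg : measurable_fun setT (fun v : TR => (- ((v - sin u) * ln (v - sin u))^-1)%:E).
  apply/measurable_EFinP; apply: measurableT_comp => //.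
  apply: measurable_fun_inv; apply: measurable_funM => //.
  exact: (measurableT_comp (@measurable_ln R) mh).
have rng (v : TR) : I v -> (0 < v - sin u <= 1 / 4)%R.
  by rewrite /I/= in_itv/= => /andP[v1 v2]; clear -v1 v2 e0; lra.
have g0 (v : TR) : I v -> 0 <= (- ((v - sin u) * ln (v - sin u))^-1)%:E.
  move=> /rng /andP[v0 v4]; rewrite lee_fin oppr_ge0 invr_le0 mulr_ge0_le0 ?(ltW v0)//.
  by apply: ln_le0; apply: (le_trans v4); clear; lra.
have k0 : 0 <= (192^-1 : R)%:E by rewrite lee_fin.
rewrite -ge0_integralZl//; last exact: measurable_funTS.
apply: ge0_le_integral => //.
- by move=> v Iv; rewrite mule_ge0// g0.
- by apply: measurable_funTS; exact: measurable_funeM.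
- exact: measurable_funTS.
move=> v /rng vr; rewrite -EFinM.
have := axial_section_ge u (v - sin u)%R cu su vr.
by rewrite (_ : sin u + (v - sin u) = v)%R//; ring.
Qed.

Lemma axial_int_pos_infty u : (1 / 2 <= cos u)%R -> (`|sin u| <= 1 / 4)%R ->
  axial_int_pos u = +oo.
Proof.
move=> cu su; apply: eq_infty => r.
pose l4 : R := (- ln (1 / 4))%R.
have l40 : (0 < l4)%R by rewrite oppr_gt0; apply: ln_lt0; lra.
(* With e = exp(-exp x) one has ln(-ln e) = x, and the lower bound becomes |r| + 1/192; the summand
   1 ensures e < 1/4 also when r = 0. *)
pose x := (192 * `|r| + 1 + ln l4)%R.
have xl : (l4 < expR x)%R.
  rewrite -[ltLHS]lnK ?posrE// ltr_expR /x.
  by have := normr_ge0 r; clear; lra.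
have er : (0 < expR (- expR x) < 1 / 4)%R.
  rewrite expR_gt0 -[ltRHS]lnK ?posrE ?divr_gt0// ltr_expR.
  by move: xl; rewrite /l4; clear; lra.
apply: le_trans (axial_int_pos_ge u _ cu su er); rewrite lee_fin.
rewrite expRK opprK expRK -/l4 /x; have := ler_norm r; clear; lra.
Qed.

Lemma arc_near_axis : exists2 t : R, (0 < t <= pi)%R &
  forall u, (0 <= u <= t)%R -> (1 / 2 <= cos u)%R /\ (`|sin u| <= 1 / 4)%R.
Proof.
have C : \forall u \near (0 : R)%R, (1 / 2 < cos u)%R.
  have := @continuous_cos R 0%R; rewrite /continuous_at cos0 => /cvgr_gt; apply.
  by rewrite ltr_pdivrMr// mul1r ltr1n.
have S : \forall u \near (0 : R)%R, (`|sin u| < 1 / 4)%R.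
  have := @continuous_sin R 0%R; rewrite /continuous_at sin0 => /cvgr0_norm_lt; apply.
  by rewrite divr_gt0.
have CS := @filterI _ (nbhs (0 : R)%R) _ _ _ C S.
have [e /= e0 eP] := (nbhs_ballP (0 : R)%R _).1 (CS (nbhs_filter _)).
have p0 := pi_gt0 R.
exists (Num.min (e / 2) pi)%R; first by rewrite lt_min divr_gt0//= p0 ge_min lexx orbT.
move=> u /andP[u0]; rewrite le_min => /andP[ue _].
have : ball (0 : R)%R e u.
  by rewrite /ball/= sub0r normrN ger0_norm//; clear -ue e0; lra.
by move=> /eP[/ltW ? /ltW ?].
Qed.

Variables (J : 'rV[R]_3 -> 'rV[R]_3) (HJ : wash_current J).

(** [f] stands for the identity or for taking the negative part; [f 0 = 0] matches the extension by
    0 off the washer. *)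
Lemma area_potential_density u (f : \bar R -> \bar R) : f 0 = 0 ->
  \int[area R]_(p in annulus) f (potential_density J (circle u) (unit_tangent circle u) (plane p))%:E
  = \int[nu]_p f (axial_on_annulus (u, p)).
Proof.
move=> f0; rewrite integral_mkcond; apply: eq_integral => p _.
rewrite patchE /axial_on_annulus /=; case: ifPn => // pA.
by rewrite potential_density_circle//; rewrite inE in pA.
Qed.

Lemma potential_circle u :
  potential J (circle u) (unit_tangent circle u) =
  ((4 * pi)^-1)%:E * (axial_int_pos u - axial_int_neg u).
Proof.
rewrite /potential /area_integral preimage_wash; congr (_ * _).
transitivity (\int[nu]_p axial_on_annulus (u, p)); first exact: (area_potential_density u id).
rewrite integralE; congr (_ - _); apply: eq_integral => p _; rewrite ?funeposE ?funenegE//.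
Qed.

Lemma potential_defined_circle u : potential_defined J (circle u) (unit_tangent circle u).
Proof.
rewrite /potential_defined preimage_wash; split.
  apply: (@eq_measurable_fun _ _ _ _ _ (fun p => axial_on_annulus (u, p))).
    move=> p pA; rewrite /axial_on_annulus /= pA potential_density_circle//.
    by rewrite inE in pA.
  apply: measurable_funTS.
  exact: (measurableT_comp measurable_axial_on_annulus (measurable_pair1 u)).
right; under eq_integral do rewrite funenegE.
rewrite (area_potential_density u (fun x => maxe (- x) 0)); last by rewrite oppe0 maxxx.
under eq_integral do rewrite -funenegE.
exact: le_lt_trans (axial_int_neg_le u) (ltry _).
Qed.

Let k : R := ((4 * pi)^-1)%R.

Let k0 : (0 < k)%R.
Proof. by rewrite invr_gt0 mulr_gt0 ?pi_gt0. Qed.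

Lemma flux_density_circle u :
  flux_density J circle u = k%:E * (axial_int_pos u - axial_int_neg u).
Proof. by rewrite /flux_density speed_circle mule1 potential_circle. Qed.

Lemma measurable_flux_density : measurable_fun setT (flux_density J circle).
Proof.
rewrite (_ : flux_density J circle = (fun u => k%:E * (axial_int_pos u - axial_int_neg u))); last first.
  by apply/funext => u; rewrite flux_density_circle.
apply: measurable_funeM; apply: emeasurable_funB.
  exact: (@measurable_fun_fubini_tonelli_F _ _ TR (TR * TR)%type R nu _
    measurable_axial_pos (fun z => funepos_ge0 _ z)).
exact: (@measurable_fun_fubini_tonelli_F _ _ TR (TR * TR)%type R nu _
    measurable_axial_neg (fun z => funeneg_ge0 _ z)).
Qed.

Lemma flux_density_neg_le u :
  (flux_density J circle)^\- u <= (k * (81 * 4 * 48))%:E.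
Proof.
rewrite funenegE ge_max; apply/andP; split; last by rewrite lee_fin mulr_ge0// ltW.
rewrite flux_density_circle leeNl -EFinN -mulrN EFinM; apply: lee_wpmul2l.
  by rewrite lee_fin ltW.
rewrite -[leLHS]add0e; apply: leeD; first by apply: integral_ge0 => p _; exact: funepos_ge0.
by rewrite EFinN leeN2 axial_int_neg_le.
Qed.

Lemma integral_flux_density_neg :
  \int[mu]_(u in `[(- pi)%R, pi]) (flux_density J circle)^\- u < +oo.
Proof.
apply: (@le_lt_trans _ _ (\int[mu]_(u in `[(- pi)%R, pi]) cst (k * (81 * 4 * 48))%:E u)).
  apply: ge0_le_integral => //.
  - apply: measurable_funTS; exact: measurable_funeneg measurable_flux_density.
  - by move=> u _; exact: flux_density_neg_le.
rewrite integral_cst//= lebesgue_measure_itv/=.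
by case: ifP => _; rewrite -?EFinB -?EFinM ?mule0 ltry.
Qed.

Lemma flux_defined_circle : flux_defined J (- pi) pi circle.
Proof.
split; first by apply: aeW => u _; exact: potential_defined_circle.
split; first exact: measurable_funTS measurable_flux_density.
by right; exact: integral_flux_density_neg.
Qed.

Lemma flux_circle : flux J (- pi) pi circle = +oo.
Proof.
have [t /andP[t0 tp] tP] := arc_near_axis.
have pos : \int[mu]_(u in `[(- pi)%R, pi]) (flux_density J circle)^\+ u = +oo.
  apply/eqP; rewrite -leye_eq.
  have mf := measurable_funepos measurable_flux_density.
  apply: (@le_trans _ _ (\int[mu]_(u in `[0%R, t]) (flux_density J circle)^\+ u)); last first.
    apply: ge0_subset_integral => //.
    - exact: measurable_funTS mf.
    - apply: subset_itv; rewrite bnd_simp//.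
      by rewrite oppr_le0 pi_ge0.
  have -> : \int[mu]_(u in `[0%R, t]) (flux_density J circle)^\+ u = \int[mu]_(u in `[0%R, t]) cst +oo u.
    apply: eq_integral => u; rewrite inE/= in_itv/= => /tP[cu su].
    rewrite funeposE flux_density_circle (axial_int_pos_infty u cu su).
    (* The negative part is finite, so the difference is not of the form +oo - oo. *)
    rewrite addye; last by rewrite eqe_oppLR/= lt_eqF// (le_lt_trans (axial_int_neg_le u)) ?ltry.
    by rewrite gt0_muley ?lte_fin// /maxe/= ltNge le0y.
  rewrite integral_cst//= lebesgue_measure_itv/= lte_fin t0 sube0.
  by rewrite gt0_mulye ?lte_fin.
have neg := integral_flux_density_neg.
rewrite /flux integralE pos addye//.
by rewrite eqe_oppLR/= lt_eqF.
Qed.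

End Flux.

Theorem theorem3p1 (R : realType) (J : 'rV[R]_3 -> 'rV[R]_3)
    (HJ : wash_current J) :
  finite_energy J /\
  exists (a b : R) (C : R -> 'rV[R]_3),
    [/\ piecewise_smooth a b C, closed_curve a b C, in_xy_plane a b C &
        (curve_length a b C < +oo)%E] /\
    [/\ flux_defined J a b C, flux J a b C = +oo%E &
        ~ exists z : complex.complex R, is_holonomy J a b C z].
Proof.
split; first exact: finite_energy_wash.
exists (- pi), pi, circle; split.
  split; [exact: piecewise_smooth_circle|exact: closed_circle| |exact: length_circle].
  by move=> u _; exists (cos u, sin u).
have F := flux_circle J HJ.
split=> //; first exact: flux_defined_circle.
(* A holonomy would need a real number Phi equal to the flux +oo. *)
by move=> [z [_ [Phi [E _]]]]; rewrite F in E.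
Qed.
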